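(* Let $p>1$ and let $u$ be a solution of (P) (with $u_0\in C(\overline\Omega)$, $u_0\ge0$) that blows up at time $T<\infty$. Then there exists a constant $C$ such that for all $t\in[0,T)$ $$(p-1)^{-1/(p-1)}(T-t)^{-1/(p-1)}\le\|u(\cdot,t)\|_{L^\infty(\Omega)}\le C(T-t)^{-1/(p-1)}.$$
   Context: Standing assumptions: $\Omega\subset\mathbb{R}^N$ bounded, connected, smooth; $J\in C(\mathbb{R}^N)$, $J\ge0$ symmetric, $\int J=1$, $J>0$ on $B(0,d)$, $J=0$ outside $B(0,d)$. There is $s_0>d$ such that $y=z+s\eta(z)$, $z\in\partial\Omega$, $s\in(0,s_0)$ ($\eta$ exterior unit normal) give coordinates on a neighborhood of $\partial\Omega$ in $\mathbb{R}^N\setminus\Omega$; $\overline u(z+s\eta(z),t)=u(z,t)$. Problem (P): $u_t(x,t)=\int_\Omega J(x-y)(u(y,t)-u(x,t))dy+\int_{\mathbb{R}^N\setminus\Omega}J(x-y)\overline u^p(y,t)dy$ for $x\in\overline\Omega$, $u(x,0)=u_0(x)$. ''Blows up at time $T$'' means $u$ is a solution on $[0,T)$ and $\|u(\cdot,t)\|_{L^\infty(\Omega)}\to\infty$ as $t\nearrow T$. *)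

(* Defs.v *)
From HB Require Import structures.
From mathcomp Require Import all_boot all_order all_algebra.
From mathcomp Require Import all_classical all_reals all_analysis.
Set Implicit Arguments. Unset Strict Implicit. Unset Printing Implicit Defensive.
Import Order.TTheory GRing.Theory Num.Theory.
Import numFieldNormedType.Exports.
Local Open Scope classical_set_scope.
Local Open Scope ring_scope.

Definition enorm (R : realType) (N : nat) (v : 'rV[R]_N) : R :=
  Num.sqrt (\sum_(i < N) v ord0 i ^+ 2).

Definition eball (R : realType) (N : nat) (c : 'rV[R]_N) (r : R) : set 'rV[R]_N :=
  [set x | enorm (x - c) < r].

(* Lebesgue integral over R^N, written as the iterated one-dimensional
   Lebesgue integral (Fubini/Tonelli); first coordinate outermost. *)
Fixpoint iint (R : realType) (n : nat) : ('rV[R]_n -> R) -> R :=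
  match n return ('rV[R]_n -> R) -> R with
  | 0 => fun f => f 0
  | n'.+1 => fun f =>
      Rintegral (@lebesgue_measure R) setT
        (fun x : R => @iint R n' (fun v : 'rV[R]_n' => f (row_mx (\row_(i < 1) x) v)))
  end.

Fixpoint iterD (R : realType) (N : nat) (vs : seq 'rV[R]_N) (f : 'rV[R]_N -> R)
  : 'rV[R]_N -> R :=
  match vs with
  | [::] => f
  | v :: vs' => fun x => derive (iterD vs' f) x v
  end.

Definition smooth (R : realType) (N : nat) (f : 'rV[R]_N -> R) : Prop :=
  (forall (vs : seq 'rV[R]_N) (v x : 'rV[R]_N), derivable (iterD vs f) x v) /\
  (forall vs : seq 'rV[R]_N, continuous (iterD vs f)).

Definition grad (R : realType) (N : nat) (f : 'rV[R]_N -> R) (x : 'rV[R]_N) : 'rV[R]_N :=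
  \row_(i < N) derive f x (delta_mx ord0 i).

Definition defining_function (R : realType) (N : nat) (Om : set 'rV[R]_N)
  (rho : 'rV[R]_N -> R) : Prop :=
  smooth rho /\ Om = [set x | rho x < 0] /\
  (forall x, rho x = 0 -> grad rho x != 0).

Definition bounded_smooth_domain (R : realType) (N : nat) (Om : set 'rV[R]_N) : Prop :=
  (exists M : R, forall x, Om x -> enorm x <= M) /\
  Om !=set0 /\ connected Om /\
  exists rho, defining_function Om rho.

Definition bdry (R : realType) (N : nat) (Om : set 'rV[R]_N) : set 'rV[R]_N :=
  closure Om `\` interior Om.

Definition ext_normal (R : realType) (N : nat) (rho : 'rV[R]_N -> R) (z : 'rV[R]_N)
  : 'rV[R]_N :=
  (enorm (grad rho z))^-1 *: grad rho z.

Definition normal_coord (R : realType) (N : nat) (Om : set 'rV[R]_N)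
  (eta : 'rV[R]_N -> 'rV[R]_N) (s0 : R) (y : 'rV[R]_N) (zs : 'rV[R]_N * R) : Prop :=
  bdry Om zs.1 /\ 0 < zs.2 < s0 /\ y = zs.1 + zs.2 *: eta zs.1.

Definition normal_coordinates (R : realType) (N : nat) (Om : set 'rV[R]_N)
  (eta : 'rV[R]_N -> 'rV[R]_N) (s0 : R) : Prop :=
  (forall y zs zs', normal_coord Om eta s0 y zs -> normal_coord Om eta s0 y zs' ->
     zs = zs') /\
  (forall y zs, normal_coord Om eta s0 y zs -> ~ Om y) /\
  (exists O : set 'rV[R]_N, open O /\ bdry Om `<=` O /\
     forall y, O y -> ~ Om y -> bdry Om y \/ exists zs, normal_coord Om eta s0 y zs).

(* The extension ubar(z + s eta(z), t) = u(z, t); (value 0 elsewhere, which is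
   irrelevant: outside a null set it is never used). *)
Definition ubar (R : realType) (N : nat) (Om : set 'rV[R]_N)
  (eta : 'rV[R]_N -> 'rV[R]_N) (s0 : R) (u : 'rV[R]_N -> R -> R)
  (y : 'rV[R]_N) (t : R) : R :=
  match pselect (exists zs, normal_coord Om eta s0 y zs) with
  | left h => u (projT1 (cid h)).1 t
  | right _ => 0
  end.

Definition rhsP (R : realType) (N : nat) (Om : set 'rV[R]_N) (J : 'rV[R]_N -> R)
  (eta : 'rV[R]_N -> 'rV[R]_N) (s0 p : R) (u : 'rV[R]_N -> R -> R)
  (x : 'rV[R]_N) (t : R) : R :=
  iint (fun y => \1_Om y * (J (x - y) * (u y t - u x t)))
  + iint (fun y => \1_(~` Om) y * (J (x - y) * (ubar Om eta s0 u y t) `^ p)).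

Definition solution_P (R : realType) (N : nat) (Om : set 'rV[R]_N) (J : 'rV[R]_N -> R)
  (eta : 'rV[R]_N -> 'rV[R]_N) (s0 p : R) (u0 : 'rV[R]_N -> R)
  (T : R) (u : 'rV[R]_N -> R -> R) : Prop :=
  {within (closure Om) `*` [set t | 0 <= t < T], continuous (fun xt => u xt.1 xt.2)} /\
  (forall x, closure Om x -> u x 0 = u0 x) /\
  (forall x t, closure Om x -> 0 < t < T ->
     is_derive t 1 (u x) (rhsP Om J eta s0 p u x t)).

(* L^infinity(Omega) norm of u(.,t) (u(.,t) is continuous, so this is a sup). *)
Definition Linf (R : realType) (N : nat) (Om : set 'rV[R]_N) (u : 'rV[R]_N -> R -> R)
  (t : R) : R :=
  sup [set `|u x t| | x in Om].

Definition blows_up (R : realType) (N : nat) (Om : set 'rV[R]_N) (J : 'rV[R]_N -> R)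
  (eta : 'rV[R]_N -> 'rV[R]_N) (s0 p : R) (u0 : 'rV[R]_N -> R)
  (T : R) (u : 'rV[R]_N -> R -> R) : Prop :=
  solution_P Om J eta s0 p u0 T u /\
  (Linf Om u t @[t --> at_left T] --> +oo).

(* Main.v *)
(** The lower bound is a comparison argument: at a spatial maximum the diffusion term is
    nonpositive and the exterior term is at most [u `^ p], since [J] has mass one.

    For the upper bound, write [B(x)] for the exterior integral at [x].  Cover the boundary by
    finitely many patches of diameter less than [d / 4].  A volume comparison between the
    exterior strips of width [d] and [d / 4] bounds [B(x)], for every [x], by a constant times
    the sum of the values of [B] at one arbitrary boundary point of each patch.  Hence
    [u(x) - C sum u(z_k)] grows at rate at most a multiple of the maximum [M], whatever the
    points [z_k] are.  Close to the blow-up time, when [M] reaches a new maximum, this forces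
    [u] to be comparable to [M] on a whole patch; there it remains so, and it feeds back
    [B >= c M^p] at the centre of the patch.  So [M] doubles within time [C M^(1-p)], and
    summing the geometric series over successive doublings gives [T - t <= C M(t)^(1-p)]. *)
Require Import Defs.
From HB Require Import structures.
From mathcomp Require Import all_boot all_order all_algebra.
From mathcomp Require Import all_classical all_reals all_analysis.
From mathcomp Require Import measurable_realfun.
From mathcomp Require Import zify ring lra.
Set Implicit Arguments.
Unset Strict Implicit.
Unset Printing Implicit Defensive.
Import Order.TTheory GRing.Theory Num.Theory.
Import numFieldNormedType.Exports.
Local Open Scope classical_set_scope.
Local Open Scope ring_scope.

(** The hypothesis on normal coordinates gives uniqueness but no Jacobian bound, so the exterior
    integral cannot be transformed by a change of variables. Instead, uniqueness forces the foot [z]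
    of [z + s eta z] to be the nearest point of the closure, and projection estimates (exterior
    balls of every radius below [s0], monotonicity, a Lipschitz bound) take its place. The iterated
    integral enters only through monotonicity under bounded majorants of bounded support and through
    its exact value on sums of indicators of cubes; translating the kernel and comparing strips thus
    become counts of grid cubes, up to an arbitrarily small error. Values of [u] at different
    boundary points are not comparable a priori. This is why each [z_k] must be free inside its
    patch: placing every [z_k] where [u] is small would exclude a large new maximum, so some patch
    has no such point. The maximum is never differentiated: records over the whole past and first
    contact times replace it. For the lower bound, a barrier starting too low would keep [u] bounded
    up to [T]. *)

(** * Iterated integrals: monotonicity and step functions *)

Section Integral.
Context {R : realType}.
Notation mu := (@lebesgue_measure R).

(* Measurability is not assumed: for nonnegative functions the library integral
   is a supremum over simple functions below. *)
Lemma ge0_le_integralT (f g : R -> \bar R) : (forall x, 0 <= f x)%E ->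
  (forall x, f x <= g x)%E -> (\int[mu]_x f x <= \int[mu]_x g x)%E.
Proof.
move=> f0 fg; have g0 x : (0 <= g x)%E by exact: le_trans (f0 x) (fg x).
rewrite !ge0_integralTE//; apply: ge_ereal_sup => _ [h /= hf <-].
by apply: ereal_sup_ubound; exists h => //= x; exact: le_trans (hf x) (fg x).
Qed.

Lemma integral_indic_itv (b1 b2 : bool) (a b : R) :
  (\int[mu]_x (\1_([set` Interval (BSide b1 a) (BSide b2 b)] : set R) x)%:E
   = (Num.max 0 (b - a))%:E)%E.
Proof.
rewrite [LHS]integral_indic//.
rewrite setIT; etransitivity; first exact: lebesgue_measure_itv.
rewrite /= lte_fin; case: ltP => ab; first by rewrite -EFinB max_r// subr_ge0 ltW.
by rewrite max_l// subr_le0.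
Qed.

Lemma integral_box_lty (f : R -> R) (A C : R) : 0 <= A -> (forall x, 0 <= f x <= C) ->
  (forall x, A <= `|x| -> f x = 0) ->
  (\int[mu]_x (f x)%:E <= (C * (A *+ 2))%:E)%E.
Proof.
move=> A0 fC fA.
have C0 : 0 <= C by case/andP: (fC 0) => a b; exact: le_trans a b.
apply: (@le_trans _ _ (\int[mu]_x (C%:E * (\1_(`[- A, A]%classic : set R) x)%:E))%E).
  apply: ge0_le_integralT => x; first by rewrite lee_fin; case/andP: (fC x).
  rewrite -EFinM lee_fin indicE.
  have [xA|xA] := boolP (x \in _); first by rewrite mulr1; case/andP: (fC x).
  rewrite mulr0 fA//; move: xA; apply: contraNT; rewrite -ltNge => xA.
  by rewrite inE/= in_itv/= -ler_norml ltW.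
rewrite ge0_integralZl//; last by apply/measurable_EFinP.
rewrite integral_indic_itv -EFinM lee_fin ler_wpM2l//=.
by rewrite ge_max opprK mulr2n lexx addr_ge0.
Qed.

(** The positive part of [f] is dominated by [g], hence has a finite integral. If the negative part
    has an infinite one, the extended integral is minus infinity, which [fine] sends to 0, still
    below the nonnegative integral of [g]. *)
Lemma Rintegral_box_le (f g : R -> R) (A C : R) : 0 <= A ->
  (forall x, f x <= g x) -> (forall x, 0 <= g x <= C) ->
  (forall x, A <= `|x| -> g x = 0) ->
  Rintegral mu setT f <= Rintegral mu setT g.
Proof.
move=> A0 fg gC gA.
have gy := integral_box_lty A0 gC gA.
have g0 : (0 <= \int[mu]_x (g x)%:E)%E.
  by apply: integral_ge0 => x _; rewrite lee_fin; case/andP: (gC x).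
have Gfin : (\int[mu]_x (g x)%:E)%E \is a fin_num.
  by rewrite ge0_fin_numE//; exact: le_lt_trans gy (ltry _).
rewrite /Rintegral integralE.
set P := (X in (X - _)%E); set Q := (X in (_ - X)%E).
have Q0 : (0 <= Q)%E by exact: integral_ge0.
have P0 : (0 <= P)%E by exact: integral_ge0.
have PG : (P <= \int[mu]_x (g x)%:E)%E.
  apply: ge0_le_integralT => // x.
  by rewrite funeposE ge_max lee_fin fg lee_fin; case/andP: (gC x).
have Pfin : P \is a fin_num.
  by rewrite ge0_fin_numE//; apply: le_lt_trans (le_trans PG gy) (ltry _).
have [Qfin|] := boolP (Q \is a fin_num).
  apply: fine_le => //; first by rewrite fin_numB Pfin Qfin.
  by apply: le_trans PG; rewrite -[leRHS]adde0; apply: leeD => //; rewrite oppe_le0.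
rewrite ge0_fin_numE// -leNgt leye_eq => /eqP ->.
by rewrite -(fineK Pfin)/= fine_ge0.
Qed.

(** Negation swaps positive and negative parts; in all infinite cases both sides are 0 through
    [fine]. *)
Lemma RintegralNf (f : R -> R) :
  Rintegral mu setT (fun x => - f x) = - Rintegral mu setT f.
Proof.
rewrite /Rintegral integralE [in RHS]integralE.
have -> : (fun x => (- f x)%:E)^\+%E = (fun x => (f x)%:E)^\-%E.
  by apply/funext => x; rewrite funeposE funenegE.
have -> : (fun x => (- f x)%:E)^\-%E = (fun x => (f x)%:E)^\+%E.
  by apply/funext => x; rewrite funeposE funenegE /= opprK.
have : (0 <= \int[mu]_x ((fun x => (f x)%:E)^\+)%E x)%E by exact: integral_ge0.
have : (0 <= \int[mu]_x ((fun x => (f x)%:E)^\-)%E x)%E by exact: integral_ge0.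
case: (\int[mu]_x _)%E => [a||]; case: (\int[mu]_x _)%E => [b||] //= _ _; rewrite ?oppr0//; lra.
Qed.

Definition slice n (f : 'rV[R]_n.+1 -> R) (x : R) : 'rV[R]_n -> R :=
  fun v => f (row_mx (\row_(i < 1) x) v).

Lemma iintS n (f : 'rV[R]_n.+1 -> R) :
  iint f = Rintegral mu setT (fun x => iint (slice f x)).
Proof. by []. Qed.

(** The support is bounded coordinate by coordinate, so that slices inherit the property with the
    same [A] and [C]. *)
Definition box_bounded n (A C : R) (f : 'rV[R]_n -> R) :=
  (forall y : 'rV[R]_n, 0 <= f y <= C) /\ (forall (y : 'rV[R]_n) i, A <= `|y ord0 i| -> f y = 0).

Lemma box_bounded_slice n A C (f : 'rV[R]_n.+1 -> R) x :
  box_bounded A C f -> box_bounded A C (slice f x).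
Proof.
move=> [fC fA]; split => [y|y i yA]; first exact: fC.
apply: (fA _ (rshift 1 i)).
by rewrite (@row_mxEr _ _ 1).
Qed.

Lemma slice_box_out n A C (f : 'rV[R]_n.+1 -> R) x v :
  box_bounded A C f -> A <= `|x| -> slice f x v = 0.
Proof.
move=> [fC fA] xA; apply: (fA _ (lshift n (ord0 : 'I_1))).
by rewrite (@row_mxEl _ _ 1) mxE.
Qed.

Lemma iint_ge0 n (f : 'rV[R]_n -> R) : (forall y, 0 <= f y) -> 0 <= iint f.
Proof.
elim: n f => [|n IH] f f0 /=; first exact: f0.
by apply: Rintegral_ge0 => x _; apply: IH.
Qed.

Lemma iint_eq0 n (f : 'rV[R]_n -> R) : (forall y, f y = 0) -> iint f = 0.
Proof.
elim: n f => [|n IH] f f0 /=; first exact: f0.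
rewrite /Rintegral integral0_eq// => x _.
by rewrite IH.
Qed.

Lemma iintN n (f : 'rV[R]_n -> R) : iint (fun y => - f y) = - iint f.
Proof.
elim: n f => [|n IH] f //.
rewrite !iintS -RintegralNf; congr (Rintegral _ _ _).
by apply/funext => x; exact: IH.
Qed.

Lemma iint_box_le n A C (f : 'rV[R]_n -> R) : 0 <= A ->
  box_bounded A C f -> iint f <= C * (A *+ 2) ^+ n.
Proof.
move=> A0; elim: n f => [|n IH] f fb.
  by rewrite expr0 mulr1 /=; case: fb => /(_ 0)/andP[].
rewrite iintS /Rintegral.
have f0 x : 0 <= iint (slice f x).
  by apply: iint_ge0 => y; case: (box_bounded_slice x fb) => /(_ y)/andP[].
have H : (\int[mu]_x (iint (slice f x))%:E <= (C * (A *+ 2) ^+ n * (A *+ 2))%:E)%E.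
  apply: integral_box_lty => // x.
    by rewrite f0/=; apply: IH; exact: box_bounded_slice.
  by move=> xA; apply: iint_eq0 => v; exact: slice_box_out fb xA.
have K : (0 <= \int[mu]_x (iint (slice f x))%:E)%E by apply: integral_ge0 => x _; rewrite lee_fin.
rewrite exprSr mulrA; move: H K; case: (\int[mu]_x _)%E => //= r.
Qed.

(* Only the majorant needs to be bounded with bounded support; [f] may be any
   function, in particular a non-measurable one. *)
Lemma iint_le n A C (f g : 'rV[R]_n -> R) : 0 <= A -> box_bounded A C g ->
  (forall y, f y <= g y) -> iint f <= iint g.
Proof.
move=> A0; elim: n f g => [|n IH] f g gb fg; first exact: fg.
rewrite !iintS.
apply: (@Rintegral_box_le _ _ A (C * (A *+ 2) ^+ n)) => // x.
- by apply: IH => [|y]; [exact: box_bounded_slice|exact: fg].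
- have bx := box_bounded_slice x gb.
  by rewrite iint_box_le// andbT; apply: iint_ge0 => y; case: bx => /(_ y)/andP[].
- by move=> xA; apply: iint_eq0 => v; exact: slice_box_out gb xA.
Qed.

(** Half-open, so that the cubes of a grid are pairwise disjoint. *)
Definition cube n (a : 'rV[R]_n) (h : R) : pred 'rV[R]_n :=
  fun y => [forall i, a ord0 i <= y ord0 i < a ord0 i + h].

(** The corners are arbitrary and the cubes may overlap; this allows the cubes of a grid to be moved
    independently. *)
Definition step n (I : Type) (r : seq I) (c : I -> R) (a : I -> 'rV[R]_n) (h : R)
  (y : 'rV[R]_n) : R := \sum_(k <- r) c k * (cube (a k) h y)%:R.

Lemma step_ge0 n I r (c : I -> R) (a : I -> 'rV[R]_n) h y :
  (forall k, 0 <= c k) -> 0 <= step r c a h y.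
Proof. by move=> c0; apply: sumr_ge0 => k _; rewrite mulr_ge0. Qed.

Lemma Rintegral_step1 I (r : seq I) (c : I -> R) (a : I -> R) (h : R) : 0 <= h ->
  (forall k, 0 <= c k) ->
  Rintegral mu setT (fun x : R => \sum_(k <- r) c k * ((a k <= x < a k + h)%R)%:R)
  = \sum_(k <- r) c k * h.
Proof.
move=> h0 c0; rewrite /Rintegral.
transitivity (fine (\int[mu]_x (\sum_(k <- r) ((c k)%:E *
    (\1_(`[a k, a k + h[%classic : set R) x)%:E)))%E).
  congr fine; apply: eq_integral => x _; rewrite -sumEFin; apply: eq_bigr => k _.
  rewrite EFinM indicE; congr (_ * ((nat_of_bool _)%:R)%:E)%E.
  by apply/idP/idP; rewrite inE/= in_itv.
have mI k : measurable_fun setT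
    (fun x : R => (\1_(`[a k, a k + h[%classic : set R) x)%:E).
  by apply/measurable_EFinP.
rewrite ge0_integral_sum; last 3 first.
- by [].
- by move=> k; apply: measurable_funeM; exact: mI.
- by move=> k x _; rewrite mule_ge0// lee_fin.
transitivity (fine (\sum_(k <- r) ((c k * h)%:E))%E); last by rewrite sumEFin.
congr fine; apply: eq_bigr => k _; rewrite ge0_integralZl; last 4 first.
- by [].
- exact: mI.
- by move=> x _; rewrite lee_fin.
- by rewrite lee_fin.
by rewrite integral_indic_itv/= addrAC subrr add0r max_r.
Qed.

Lemma cube_row_mx n (a : 'rV[R]_n.+1) h x (v : 'rV[R]_n) :
  cube a h (row_mx (\row_(i < 1) x) v) =
  (a ord0 ord0 <= x < a ord0 ord0 + h) &&
  cube (\row_i a ord0 (rshift 1 i)) h v.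
Proof.
have e0 : lshift n (ord0 : 'I_1) = ord0 by apply/val_inj.
apply/forallP/andP => [H|[H0 /forallP H] i].
  split; first by have := H (lshift n (ord0 : 'I_1)); rewrite (@row_mxEl _ _ 1) mxE e0.
  by apply/forallP => i; have := H (rshift 1 i); rewrite (@row_mxEr _ _ 1) !mxE.
case: (@split_ordP 1 n i) => j ->.
  by rewrite (@row_mxEl _ _ 1) mxE (ord1 j) e0.
by rewrite (@row_mxEr _ _ 1); have := H j; rewrite !mxE.
Qed.

(** A slice of a step function is a step function: the condition on the first coordinate moves into
    the coefficients. *)
Lemma iint_step n I (r : seq I) (c : I -> R) (a : I -> 'rV[R]_n) h : 0 <= h ->
  (forall k, 0 <= c k) -> iint (step r c a h) = \sum_(k <- r) c k * h ^+ n.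
Proof.
move=> h0; elim: n c a => [|n IH] c a c0.
  apply: eq_bigr => k _; rewrite expr0; congr (_ * _).
  by rewrite (_ : cube _ _ _)//; apply/forallP => -[].
rewrite iintS.
transitivity (Rintegral mu setT
   (fun x : R => \sum_(k <- r) (c k * h ^+ n) * ((a k ord0 ord0 <= x < a k ord0 ord0 + h)%R)%:R)).
  congr (Rintegral _ _ _); apply/funext => x.
  pose c' k := c k * ((a k ord0 ord0 <= x < a k ord0 ord0 + h)%R)%:R.
  pose a' k := \row_i a k ord0 (rshift 1 i).
  have -> : slice (step r c a h) x = step r c' a' h.
    apply/funext => v; apply: eq_bigr => k _.
    by rewrite cube_row_mx -mulnb natrM mulrA.
  rewrite IH; last by move=> k; rewrite mulr_ge0.
  by apply: eq_bigr => k _; rewrite /c' mulrAC.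
rewrite Rintegral_step1//; last by move=> k; rewrite mulr_ge0// exprn_ge0.
by apply: eq_bigr => k _; rewrite exprSr mulrA.
Qed.

End Integral.


(** * Euclidean geometry, and its agreement with the topology of the maximum norm *)

Section Euclid.
Context {R : realType} {N : nat}.
Implicit Types (v w x y z : 'rV[R]_N).

Definition dot v w : R := \sum_i v ord0 i * w ord0 i.

Lemma dotC v w : dot v w = dot w v.
Proof. by apply: eq_bigr => i _; rewrite mulrC. Qed.

Lemma dotDl v w x : dot (v + w) x = dot v x + dot w x.
Proof. by rewrite /dot -big_split/=; apply: eq_bigr => i _; rewrite mxE mulrDl. Qed.

Lemma dotZl (a : R) v w : dot (a *: v) w = a * dot v w.
Proof. by rewrite /dot mulr_sumr; apply: eq_bigr => i _; rewrite mxE mulrA. Qed.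

Lemma dotNl v w : dot (- v) w = - dot v w.
Proof. by rewrite -scaleN1r dotZl mulN1r. Qed.

Lemma dotDr v w x : dot x (v + w) = dot x v + dot x w.
Proof. by rewrite dotC dotDl !(dotC x). Qed.

Lemma dotZr (a : R) v w : dot v (a *: w) = a * dot v w.
Proof. by rewrite dotC dotZl dotC. Qed.

Lemma dotNr v w : dot v (- w) = - dot v w.
Proof. by rewrite dotC dotNl dotC. Qed.

Definition dotE := (dotDl, dotDr, dotNl, dotNr, dotZl, dotZr).

Lemma dot_ge0 v : 0 <= dot v v.
Proof. by apply: sumr_ge0 => i _; rewrite -expr2 sqr_ge0. Qed.

Lemma enormE v : enorm v = Num.sqrt (dot v v).
Proof. by congr Num.sqrt; apply: eq_bigr => i _; rewrite expr2. Qed.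

Lemma enorm_ge0 v : 0 <= enorm v.
Proof. exact: sqrtr_ge0. Qed.

Lemma sqr_enorm v : enorm v ^+ 2 = dot v v.
Proof. by rewrite enormE sqr_sqrtr// dot_ge0. Qed.

Lemma coord_le_enorm v i : `|v ord0 i| <= enorm v.
Proof.
rewrite -(@ler_pXn2r _ 2) ?nnegrE ?enorm_ge0// sqr_enorm real_normK ?num_real//.
rewrite /dot (bigD1 i)//= -expr2 lerDl.
by apply: sumr_ge0 => j _; rewrite -expr2 sqr_ge0.
Qed.

Lemma enorm0 : enorm (0 : 'rV[R]_N) = 0.
Proof. by rewrite enormE /dot big1 ?sqrtr0// => i _; rewrite mxE mul0r. Qed.

Lemma enorm_eq0 v : (enorm v == 0) = (v == 0).
Proof.
apply/eqP/eqP => [v0|->]; last exact: enorm0.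
apply/rowP => i; rewrite mxE; apply/eqP; rewrite -normr_le0 -v0.
exact: coord_le_enorm.
Qed.

Lemma enorm_gt0 v : (0 < enorm v) = (v != 0).
Proof. by rewrite lt_def enorm_ge0 andbT enorm_eq0. Qed.

Lemma enormZ (a : R) v : enorm (a *: v) = `|a| * enorm v.
Proof.
rewrite !enormE dotZl dotZr mulrA -expr2 sqrtrM ?sqr_ge0//.
by rewrite sqrtr_sqr.
Qed.

Lemma enormN v : enorm (- v) = enorm v.
Proof. by rewrite -scaleN1r enormZ normrN1 mul1r. Qed.

Lemma enormC v w : enorm (v - w) = enorm (w - v).
Proof. by rewrite -enormN opprB. Qed.

(** Cauchy-Schwarz, from the squared length of the component of [v] orthogonal to [w]. *)
Lemma dot_le_enorm v w : dot v w <= enorm v * enorm w.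
Proof.
have [->|w0] := eqVneq w 0.
  by rewrite enorm0 mulr0 /dot big1// => i _; rewrite mxE mulr0.
have nw : 0 < enorm w by rewrite enorm_gt0.
have nw2 : 0 < dot w w by rewrite -sqr_enorm exprn_gt0.
have := dot_ge0 (v - (dot v w / dot w w) *: w).
rewrite !dotE (dotC w v).
rewrite [X in 0 <= X](_ : _ = dot v v - dot v w ^+ 2 / dot w w); last first.
  by field; rewrite gt_eqF.
rewrite subr_ge0 ler_pdivrMr// -!sqr_enorm -exprMn => H.
apply: le_trans (ler_norm _) _.
by rewrite -(@ler_pXn2r _ 2) ?nnegrE ?mulr_ge0 ?enorm_ge0// real_normK ?num_real.
Qed.

Lemma ler_enormD v w : enorm (v + w) <= enorm v + enorm w.
Proof.
rewrite -(@ler_pXn2r _ 2) ?nnegrE ?addr_ge0 ?enorm_ge0//.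
rewrite sqr_enorm sqrrD !sqr_enorm !dotE (dotC w v).
have := dot_le_enorm v w; lra.
Qed.

Lemma ler_enorm_dist x y z : enorm (x - z) <= enorm (x - y) + enorm (y - z).
Proof. by apply: le_trans (ler_enormD _ _); rewrite addrA subrK. Qed.

Lemma enorm_dist_ge x y : enorm x - enorm y <= enorm (x - y).
Proof. by rewrite lerBlDr; apply: le_trans (ler_enormD _ _); rewrite subrK. Qed.

(** Triangle inequality along the coordinate vectors. The crude factor [N] is the source of the
    multiples of [N.+1] in the later mesh constants. *)
Lemma enorm_le_cube v (r : R) : 0 <= r -> (forall i, `|v ord0 i| <= r) ->
  enorm v <= N%:R * r.
Proof.
move=> r0 vr.
apply: (@le_trans _ _ (\sum_i enorm (v ord0 i *: (delta_mx ord0 i : 'rV[R]_N)))).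
  rewrite {1}(row_sum_delta v); elim/big_ind2 : _ => [|a b c d ab cd|//].
    by rewrite enorm0.
  by apply: le_trans (ler_enormD _ _) _; exact: lerD.
apply: (@le_trans _ _ (\sum_(i < N) r)); last by rewrite sumr_const card_ord mulr_natl.
apply: ler_sum => i _; rewrite enormZ.
suff -> : enorm (delta_mx ord0 i : 'rV[R]_N) = 1 by rewrite mulr1.
rewrite enormE /dot (bigD1 i)//= big1 ?addr0 => [|j ji].
  by rewrite mxE !eqxx/= mulr1 sqrtr1.
by rewrite mxE eqxx (negPf ji) mul0r.
Qed.

Lemma mx_norm_le_enorm v : `|v| <= enorm v.
Proof.
rewrite [leLHS]/Num.norm/= mx_normrE; apply/bigmax_leP; split; first exact: enorm_ge0.
by move=> [i j] _ /=; rewrite (ord1 i) coord_le_enorm.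
Qed.

Lemma coord_le_mx_norm v i : `|v ord0 i| <= `|v|.
Proof.
rewrite [leRHS]/Num.norm/= mx_normrE.
exact: (@le_bigmax _ _ _ _ (fun ij : 'I_1 * 'I_N => `|v ij.1 ij.2|) (ord0, i)).
Qed.

Lemma enorm_le_mx_norm v : enorm v <= N%:R * `|v|.
Proof. by apply: enorm_le_cube => // i; exact: coord_le_mx_norm. Qed.

Lemma nbhs_eballP x (A : set 'rV[R]_N) :
  nbhs x A <-> exists2 e : R, 0 < e & forall y, enorm (y - x) < e -> A y.
Proof.
split=> [/nbhs_normP[e /= e0 eA]|[e e0 eA]].
  exists e => // y ye; apply: eA => /=.
  by rewrite distrC; exact: le_lt_trans (mx_norm_le_enorm _) ye.
(* Dividing by [N.+1] instead of [N] keeps the radius positive in dimension 0. *)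
apply/(@nbhs_normP R 'rV[R]_N x); exists (e / N.+1%:R) => /=; first exact: divr_gt0.
move=> y /= xy; apply: eA.
rewrite enormC; apply: le_lt_trans (enorm_le_mx_norm _) _.
rewrite ltr_pdivlMr// mulrC in xy.
by apply: le_lt_trans xy; rewrite ler_wpM2r// ler_nat.
Qed.

Lemma continuous_eballP (f : 'rV[R]_N -> R) : continuous f <->
  forall x (e : R), 0 < e -> exists2 r : R, 0 < r &
    forall y, enorm (y - x) < r -> `|f x - f y| < e.
Proof.
split=> [cf x e e0|H x]; last first.
  apply/(@cvgrPdist_lt _ _ _ (nbhs x)) => e e0; have [r r0 rP] := H x e e0.
  by apply/nbhs_eballP; exists r.
have /(@cvgrPdist_lt _ _ _ (nbhs x))/(_ e e0)/nbhs_eballP[r r0 rP] := cf x.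
by exists r.
Qed.

Lemma enorm_dist_continuous y : continuous (fun x => enorm (y - x)).
Proof.
apply/continuous_eballP => x e e0; exists e => // z zx.
apply: le_lt_trans zx; rewrite ler_norml lerBrDr lerBlDr; apply/andP; split.
  by have := ler_enorm_dist y x z; rewrite (enormC x); lra.
by have := ler_enorm_dist y z x; lra.
Qed.

Lemma closure_eballP (A : set 'rV[R]_N) x :
  closure A x <-> forall e : R, 0 < e -> exists2 y, A y & enorm (y - x) < e.
Proof.
split=> [cA e e0|H B /nbhs_eballP[e e0 eB]].
  have /cA[y [Ay /= ye]] : nbhs x [set y | enorm (y - x) < e].
    by apply/nbhs_eballP; exists e.
  by exists y.
by have [y Ay ye] := H _ e0; exists y; split => //; exact: eB.
Qed.

Lemma closed_enorm_bounded_compact (A : set 'rV[R]_N) (M : R) : closed A ->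
  (forall x, A x -> enorm x <= M) -> compact A.
Proof.
move=> cA AM; apply: bounded_closed_compact => //.
exists M; split; first exact: num_real.
by move=> B MB x /AM xM; apply: le_trans (mx_norm_le_enorm _) (le_trans xM (ltW MB)).
Qed.

Lemma closure_enorm_bounded (A : set 'rV[R]_N) (M : R) :
  (forall x, A x -> enorm x <= M) -> forall x, closure A x -> enorm x <= M.
Proof.
move=> AM x /closure_eballP cx; apply/ler_addgt0Pr => e e0.
have [y Ay ye] := cx _ e0.
have := enorm_dist_ge x y; rewrite (enormC x); have := AM _ Ay; lra.
Qed.

Lemma closure_compact (A : set 'rV[R]_N) (M : R) :
  (forall x, A x -> enorm x <= M) -> compact (closure A).
Proof.
move=> AM; apply: (@closed_enorm_bounded_compact _ M); first exact: closed_closure.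
exact: closure_enorm_bounded.
Qed.

Lemma nearest_point (K : set 'rV[R]_N) y : compact K -> K !=set0 ->
  exists2 z, K z & forall x, K x -> enorm (y - z) <= enorm (y - x).
Proof.
move=> cK K0.
have [|z /set_mem Kz zmin] := @compact_EVT_min _ R (fun x => enorm (y - x)) K K0 cK.
  by apply: continuous_subspaceT; exact: enorm_dist_continuous.
by exists z => // x Kx; apply: zmin; exact/mem_set.
Qed.

Lemma finite_net (K : set 'rV[R]_N) (r : R) : compact K -> 0 < r ->
  exists s : seq 'rV[R]_N, (forall c, c \in s -> K c) /\
    forall x, K x -> exists2 c, c \in s & enorm (x - c) < r.
Proof.
rewrite compact_cover => cK r0.
have [||D sD KD] := cK _ K (fun c => [set x | enorm (x - c) < r]).
- move=> c _; rewrite openE => x /= xc; apply/nbhs_eballP.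
  exists (r - enorm (x - c)); first by rewrite subr_gt0.
  by move=> y yx /=; have := ler_enorm_dist y x c; lra.
- by move=> x Kx; exists x => //=; rewrite subrr enorm0.
exists (finmap.enum_fset D); split=> [c cD|x /KD[c /= cD xc]]; last by exists c.
by have := sD c cD; rewrite inE.
Qed.

End Euclid.

(** Heine-Cantor through the near-covering form of compactness, with the radius as the parameter
    tending to 0 from the right. *)
Lemma compact_unif_continuous (R : realType) (V : normedModType R) (K : set V) (f : V -> R) :
  compact K -> {within K, continuous f} -> forall e : R, 0 < e ->
  exists2 r : R, 0 < r & forall x y, K x -> K y -> `|x - y| < r -> `|f x - f y| < e.
Proof.
move=> /compact_near_coveringP/near_covering_withinP cK /subspace_continuousP cf e e0.
pose P (r : R) x := K x -> forall y, K y -> `|x - y| < r -> `|f x - f y| < e.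
suff : \forall r \near (0 : R)^'+, K `<=` P r.
  move=> H.
  have [r [/= r0 rP]] := filter_ex (filterI (nbhs_right_gt (0 : R)) H).
  by exists r => // x y Kx Ky; exact: rP.
apply: cK => x0 Kx0.
have e2 : 0 < e / 2 by lra.
have /cvgrPdist_lt/(_ _ e2) := cf x0 Kx0.
rewrite near_withinE => /nbhs_normP[r /= r0 rP].
have r2 : 0 < r / 2 by lra.
exists ([set x | `|x0 - x| < r / 2], [set s : R | s < r / 2]) => /=.
  by split; [apply/nbhs_normP; exists (r / 2)|exact: nbhs_right_lt].
move=> [x s] /= [xr sr] Kx _ y Ky xy.
have hx : `|f x0 - f x| < e / 2 by apply: rP => //=; lra.
have hy : `|f x0 - f y| < e / 2.
  apply: rP => //=; have := ler_distD x x0 y; lra.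
have := ler_distD (f x0) (f x) (f y); rewrite (distrC (f x) (f x0)); lra.
Qed.


(** * Grids of cubes, and the mass of a translated kernel *)

Section Grid.
Context {R : realType}.

Lemma step_box_bounded N (I : finType) (c : I -> R) (a : I -> 'rV[R]_N) (h : R) :
  0 <= h -> (forall k, 0 <= c k) ->
  exists A C : R, 0 <= A /\ box_bounded A C (step (enum I) c a h).
Proof.
move=> h0 c0; exists (1 + \sum_k (`|a k| + h)), (\sum_k c k); split.
  by rewrite addr_ge0// sumr_ge0// => k _; rewrite addr_ge0.
split=> [y|y i yA].
  rewrite step_ge0//= /step big_enum/=; apply: ler_sum => k _.
  by rewrite ler_piMr//; case: (cube _ _ _).
rewrite /step big1// => k _; case: (boolP (cube _ _ _)) => [/forallP/(_ i)/andP[l1 l2]|]; last by rewrite mulr0.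
exfalso; move: yA; apply/negP; rewrite -ltNge.
have H : `|a k| + h <= \sum_j (`|a j| + h).
  by rewrite (bigD1 k)//= lerDl sumr_ge0// => j _; rewrite addr_ge0.
have := coord_le_mx_norm (a k) i; rewrite ler_norml => /andP[n1 n2].
rewrite ltr_norml; apply/andP; split; lra.
Qed.

(** An upper Riemann sum: one cube with a large enough coefficient suffices at each point, the other
    terms being nonnegative. *)
Lemma iint_le_step N (I : finType) (c : I -> R) (a : I -> 'rV[R]_N) (h : R)
  (f : 'rV[R]_N -> R) : 0 <= h -> (forall k, 0 <= c k) ->
  (forall y, f y <= 0 \/ exists2 k, cube (a k) h y & f y <= c k) ->
  iint f <= \sum_k c k * h ^+ N.
Proof.
move=> h0 c0 fc; have [A [C [A0 b]]] := step_box_bounded a h0 c0.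
rewrite -big_enum -(iint_step _ a h0 c0); apply: (iint_le A0 b) => y.
have [f0|[k ky fk]] := fc y; first by apply: le_trans f0 _; exact: step_ge0.
apply: (le_trans fk); rewrite /step big_enum/= (bigD1 k)//= ky mulr1 lerDl.
by apply: sumr_ge0 => l _; rewrite mulr_ge0.
Qed.

Lemma cube_diam N (a y y' : 'rV[R]_N) (h : R) : 0 <= h -> cube a h y -> cube a h y' ->
  enorm (y - y') <= N%:R * h.
Proof.
move=> h0 /forallP Hy /forallP Hy'; apply: enorm_le_cube => // i.
rewrite !mxE ler_norml; have /andP[a1 a2] := Hy i; have /andP[b1 b2] := Hy' i.
by apply/andP; split; lra.
Qed.

Lemma cube_corner N (a : 'rV[R]_N) (h : R) : 0 < h -> cube a h a.
Proof. by move=> h0; apply/forallP => i; rewrite lexx ltrDl. Qed.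

Definition gridstep (A : R) (m : nat) : R := A *+ 2 / m%:R.

Definition gridpt N (A : R) (m : nat) (k : {ffun 'I_N -> 'I_m}) : 'rV[R]_N :=
  \row_i (- A + gridstep A m * (k i)%:R).

Lemma gridstep_gt0 (A : R) m : 0 < A -> (0 < m)%N -> 0 < gridstep A m.
Proof. by move=> A0 m0; rewrite divr_gt0// ?mulrn_wgt0 ?ltr0n. Qed.

Lemma grid_cover N (A : R) m (y : 'rV[R]_N) : 0 < A -> (0 < m)%N ->
  (forall i, `|y ord0 i| < A) ->
  exists k : {ffun 'I_N -> 'I_m}, cube (gridpt A k) (gridstep A m) y.
Proof.
move=> A0 m0 yA; have h0 := gridstep_gt0 A0 m0; set h := gridstep A m in h0 *.
have P i : (Num.truncn ((y ord0 i + A) / h) < m)%N.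
  have /andP[y1 y2] : - A < y ord0 i < A by rewrite -ltr_norml.
  have q0 : 0 <= (y ord0 i + A) / h by rewrite divr_ge0 ?(ltW h0)//; lra.
  have /andP[t1 t2] := truncn_itv q0.
  rewrite -(ltr_nat R); apply: le_lt_trans t1 _.
  rewrite ltr_pdivrMr// /h /gridstep mulrCA divff ?mulr1 ?pnatr_eq0 -?lt0n//.
  by rewrite mulr2n; lra.
exists [ffun i => Ordinal (P i)]; apply/forallP => i; rewrite mxE ffunE /= -/h.
have /andP[y1 y2] : - A < y ord0 i < A by rewrite -ltr_norml.
have q0 : 0 <= (y ord0 i + A) / h by rewrite divr_ge0 ?(ltW h0)//; lra.
have /andP[] := truncn_itv q0.
rewrite ler_pdivlMr// ltr_pdivrMr// -[(Num.truncn _).+1%:R]natr1 => t1 t2.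
by apply/andP; split; lra.
Qed.

(** Indices are integers, so a gap below [L + 1] mesh widths is a gap of at most [L] indices. The
    case [L = 0] gives disjointness of the cubes, a large [L] bounded overlap. *)
Lemma grid_coord_near N (A : R) m (L : nat) (k l : {ffun 'I_N -> 'I_m}) (i : 'I_N) :
  0 < A -> (0 < m)%N ->
  `|(gridpt A k - gridpt A l) ord0 i| < L.+1%:R * gridstep A m -> (k i <= l i + L)%N.
Proof.
move=> A0 m0; have h0 := gridstep_gt0 A0 m0; rewrite !mxE ltr_norml => /andP[_ H].
rewrite -ltnS -addnS -(ltr_nat R) natrD.
rewrite -(@ltr_pM2l _ (gridstep A m))//; lra.
Qed.

(** The offsets [l i + L - k i] determine [l] and take [2 L + 1] values; membership keeps the
    truncated subtraction exact. *)
Lemma grid_near_card N m (L : nat) (k : {ffun 'I_N -> 'I_m}) :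
  (#|[set l : {ffun 'I_N -> 'I_m} | [forall i, (k i <= l i + L)%N && (l i <= k i + L)%N]]|
   <= (2 * L).+1 ^ N)%N.
Proof.
set D := [set _ | _].
pose phi (l : {ffun 'I_N -> 'I_m}) : {ffun 'I_N -> 'I_(2 * L).+1} :=
  [ffun i => inord (l i + L - k i)].
have inj : {in D &, injective phi}.
  move=> l1 l2; rewrite !inE => /forallP H1 /forallP H2 /ffunP E.
  apply/ffunP => i; apply/val_inj => /=.
  have := E i; rewrite !ffunE => /(congr1 val) /=.
  have /andP[a1 a2] := H1 i; have /andP[b1 b2] := H2 i.
  rewrite !inordK; lia.
rewrite -(card_in_imset inj); apply: leq_trans (max_card _) _.
by rewrite card_ffun !card_ord.
Qed.

Lemma grid_card_volume N (A : R) m : (0 < m)%N ->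
  \sum_(k : {ffun 'I_N -> 'I_m}) gridstep A m ^+ N = (A *+ 2) ^+ N.
Proof.
move=> m0; rewrite sumr_const -mulr_natr card_ffun !card_ord natrX -exprMn.
by rewrite /gridstep divfK// pnatr_eq0 -lt0n.
Qed.

Lemma gridpt_enorm N (A : R) m (k : {ffun 'I_N -> 'I_m}) : 0 < A ->
  enorm (gridpt A k) <= N%:R * A.
Proof.
move=> A0; apply: enorm_le_cube; first exact: ltW.
move=> i; rewrite mxE /gridstep.
have m0 : (0 < m)%N by apply: leq_trans (ltn_ord (k i)).
have : A *+ 2 / m%:R * (k i)%:R <= A *+ 2.
  rewrite -mulrA ler_piMr ?mulrn_wge0 ?(ltW A0)// mulrC.
  by rewrite ler_pdivrMr ?ltr0n// mul1r ler_nat ltnW.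
have : 0 <= A *+ 2 / m%:R * (k i)%:R by rewrite mulr_ge0// divr_ge0// mulrn_wge0// ltW.
by rewrite ler_norml mulr2n => *; apply/andP; split; lra.
Qed.

Lemma small_gridstep (A e : R) : 0 < e -> exists2 m, (0 < m)%N & gridstep A m < e.
Proof.
move=> e0; exists (Num.truncn (`|A *+ 2| / e)).+1 => //.
rewrite /gridstep ltr_pdivrMr ?ltr0n// mulrC -ltr_pdivrMr//.
apply: le_lt_trans (truncnS_gt _).
by rewrite ler_wpM2r ?invr_ge0 ?(ltW e0)// ler_norm.
Qed.

Section Kernel.
Context {N : nat} (J : 'rV[R]_N -> R) (d : R).
Hypotheses (cJ : continuous J) (J0 : forall x, 0 <= J x) (Jsym : forall x, J (- x) = J x).
Hypotheses (J1 : iint J = 1) (d0 : 0 < d) (Jd : forall x, d <= enorm x -> J x = 0).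

Lemma eball_compact (r : R) : compact [set x : 'rV[R]_N | enorm x <= r].
Proof.
apply: (@closed_enorm_bounded_compact _ _ _ r) => //.
have -> : [set x : 'rV[R]_N | enorm x <= r] = (fun x => enorm (0 - x)) @^-1` [set y | y <= r].
  by apply/seteqP; split => x /=; rewrite sub0r enormN.
apply: preimage_closed; last exact: closed_le.
by move=> x _; apply: enorm_dist_continuous.
Qed.

Lemma kernel_bounded : exists2 C : R, 0 < C & forall x, J x <= C.
Proof.
have [||c _ H] := @compact_EVT_max _ R J [set x | enorm x <= d] _ (@eball_compact d).
- by exists 0; rewrite /= enorm0 ltW.
- exact: continuous_subspaceT.
exists (J c + 1) => [|x]; first by rewrite ltr_wpDl.
have [xd|xd] := leP d (enorm x).
  by rewrite Jd// addr_ge0.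
by apply: le_trans (H x _) _; rewrite ?lerDl// inE /= ltW.
Qed.

Lemma kernel_lower (r : R) : 0 <= r -> (forall x, enorm x <= r -> 0 < J x) ->
  exists2 c : R, 0 < c & forall x, enorm x <= r -> c <= J x.
Proof.
move=> r0 Jr.
have [||c /set_mem /= cr H] := @compact_EVT_min _ R J [set x | enorm x <= r] _ (@eball_compact r).
- by exists 0; rewrite /= enorm0.
- exact: continuous_subspaceT.
by exists (J c) => [|x xr]; [exact: Jr|apply: H; rewrite inE].
Qed.

Lemma kernel_box_bounded (c : R) x : 0 <= c ->
  exists A C : R, 0 <= A /\ box_bounded A C (fun y => c * J (x - y)).
Proof.
move=> c0; have [C C0 JC] := kernel_bounded.
exists (enorm x + d), (c * C); split; first by rewrite addr_ge0 ?enorm_ge0// ltW.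
split => [y|y i yA]; first by rewrite mulr_ge0//= ler_wpM2l.
rewrite Jd ?mulr0//; have := coord_le_enorm y i; have := enorm_dist_ge y x.
by rewrite (enormC y); lra.
Qed.

(* Translation invariance is only used as this inequality, obtained by
   translating a step function that dominates [J]. *)
Lemma iint_kernel_le (c : R) x : 0 <= c -> iint (fun y => c * J (x - y)) <= c.
Proof.
move=> c0; pose A := d + 1; have A0 : 0 < A by rewrite addr_gt0.
(* Here [e] is the oscillation of [J] on a cube: upper and lower sums differ by [2 e] per unit
   volume on a box of side [2 A]. *)
suff H e : 0 < e -> iint (fun y => c * J (x - y)) <= c * (1 + e *+ 2 * (A *+ 2) ^+ N).
  apply/ler_addgt0Pr => e e0.
  pose V := c * (2 * (A *+ 2) ^+ N).
  have V0 : 0 <= V by rewrite !mulr_ge0// exprn_ge0// mulrn_wge0// ltW.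
  have V1 : 0 < V + 1 by rewrite ltr_wpDl.
  have /H : 0 < e / (V + 1) by rewrite divr_gt0.
  move/le_trans; apply.
  have -> : c * (1 + e / (V + 1) *+ 2 * (A *+ 2) ^+ N) = c + e * (V / (V + 1)).
    by rewrite /V -mulr_natl; field; rewrite gt_eqF.
  by rewrite lerD2l ler_piMr ?(ltW e0)// ler_pdivrMr// mul1r lerDl.
(* A ball containing all grid corners (norm at most [N A]) and all points of their cubes, the mesh
   being below 1. *)
move=> e0; pose B := N%:R * A + d + N%:R + 1.
have [r r0 rP] := compact_unif_continuous (@eball_compact B) (continuous_subspaceT cJ) e0.
have q0 : 0 < Num.min 1 (r / N.+1%:R) by rewrite lt_min ltr01 divr_gt0.
have [m m0 mh] := small_gridstep A q0.
have h0 := gridstep_gt0 A0 m0.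
set h := gridstep A m in mh h0.
have osc (k : {ffun 'I_N -> 'I_m}) y : cube (gridpt A k) h y -> `|J (gridpt A k) - J y| < e.
  move=> ky; have g := gridpt_enorm k A0.
  have kk := cube_corner (gridpt A k) h0.
  have D := cube_diam (ltW h0) kk ky.
  have h1 : h < 1 by apply: lt_le_trans mh _; rewrite ge_min lexx.
  have hr : h < r / N.+1%:R by apply: lt_le_trans mh _; rewrite ge_min lexx orbT.
  have N0 : 0 <= N%:R :> R by [].
  have Nh : N%:R * h <= N%:R by rewrite ler_piMr// ltW.
  have dp : 0 < d := d0.
  apply: rP; rewrite /= /B.
  - lra.
  - have := enorm_dist_ge y (gridpt A k); rewrite (enormC y); lra.
  - apply: le_lt_trans (mx_norm_le_enorm _) _; apply: le_lt_trans D _.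
    rewrite ltr_pdivlMr// in hr; apply: le_lt_trans hr.
    by rewrite mulrC ler_wpM2l ?(ltW h0)// ler_nat.
pose c1 (k : {ffun 'I_N -> 'I_m}) := c * (J (gridpt A k) + e).
(* The corners are shifted by [x]; the coefficients remain the values of [J] on the unshifted
   grid. *)
have up : iint (fun y => c * J (x - y)) <= \sum_k c1 k * h ^+ N.
  apply: (@iint_le_step _ _ _ (fun k => gridpt A k + x)); first exact: ltW.
    by move=> k; rewrite mulr_ge0// addr_ge0// ltW.
  move=> y; have [yd|yd] := leP d (enorm (y - x)).
    by left; rewrite -Jsym opprB Jd// mulr0.
  right; have [|k ky] := @grid_cover N A m (y - x) A0 m0.
    by move=> i; apply: le_lt_trans (coord_le_enorm _ i) _; rewrite /A; lra.
  exists k.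
    apply/forallP => i; have /forallP/(_ i) := ky.
    have -> : (y - x) ord0 i = y ord0 i - x ord0 i by rewrite !mxE.
    have -> : (gridpt A k + x) ord0 i = gridpt A k ord0 i + x ord0 i by rewrite mxE.
    by rewrite -/h => /andP[? ?]; apply/andP; split; lra.
  rewrite ler_wpM2l// -Jsym opprB; have := osc _ _ ky; rewrite ltr_norml => /andP[? ?]; lra.
(* A step function below [J] on the unshifted grid: its integral is at most the mass 1, which bounds
   the upper sum for the shifted grid. *)
pose c2 (k : {ffun 'I_N -> 'I_m}) := Num.max 0 (J (gridpt A k) - e).
have c20 k : 0 <= c2 k by rewrite le_max lexx.
have low : \sum_k c2 k * h ^+ N <= 1.
  rewrite -J1 -big_enum -(iint_step _ (@gridpt N A m) (ltW h0) c20).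
  have [A' [C' [A'0 b]]] := kernel_box_bounded 0 ler01.
  have -> : J = fun y => 1 * J (0 - y) by apply/funext => y; rewrite mul1r sub0r Jsym.
  apply: (iint_le A'0 b) => y.
  rewrite mul1r sub0r Jsym /step big_enum/=.
  have [[k ky]|no] := pselect (exists k : {ffun 'I_N -> 'I_m}, cube (gridpt A k) h y); last first.
    by rewrite big1// => k _; case: (boolP (cube _ _ _)) => [ky|]; [case: no; exists k|rewrite mulr0].
  rewrite (bigD1 k)//= ky mulr1 big1 ?addr0 => [|l lk].
    rewrite ge_max J0/=; have := osc _ _ ky; rewrite ltr_norml => /andP[? ?]; lra.
  case: (boolP (cube _ _ _)) => [ly|]; last by rewrite mulr0.
  (* Two half-open cubes sharing a point have corners less than one mesh width apart, hence equal
     indices. *)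
  case/eqP: lk; apply/ffunP => i; apply/val_inj/eqP; rewrite eqn_leq.
  have /forallP/(_ i)/andP[p1 p2] := ky; have /forallP/(_ i)/andP[q1 q2] := ly.
  rewrite -[X in _ && (_ <= X)%N]addn0 -[X in (_ <= X)%N && _]addn0.
  apply/andP; split; apply: (@grid_coord_near _ A m) => //; rewrite -/h mul1r;
    rewrite !mxE -/h in p1 p2 q1 q2 *; rewrite ltr_norml; apply/andP; split; lra.
apply: le_trans up _.
apply: (@le_trans _ _ (\sum_(k : {ffun 'I_N -> 'I_m}) (c * (c2 k * h ^+ N) + c * (e *+ 2) * h ^+ N))).
  apply: ler_sum => k _; rewrite mulrA -mulrDl ler_wpM2r ?exprn_ge0 ?(ltW h0)//.
  rewrite -mulrDr ler_wpM2l// mulr2n.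
  have : J (gridpt A k) - e <= c2 k by rewrite le_max lexx orbT.
  lra.
rewrite big_split/= -!mulr_sumr grid_card_volume// [leRHS]mulrDr !mulrA lerD2r.
by rewrite ler_wpM2l.
Qed.

End Kernel.
End Grid.


(** * Linearity of the directional derivative in its direction *)

Section DirectionalDerivative.
Context {R : realType} {N : nat} (rho : 'rV[R]_N -> R).
Hypothesis smooth_rho : smooth rho.

Lemma smooth_derivable x v : derivable rho x v.
Proof. by case: smooth_rho => /(_ [::]). Qed.

Lemma smooth_derive_continuous v : continuous (fun x => derive rho x v).
Proof. by case: smooth_rho => _ /(_ [:: v]). Qed.

Lemma smooth_continuous : continuous rho.
Proof. by case: smooth_rho => _ /(_ [::]). Qed.

Lemma is_derive_line x v (h : R) :
  is_derive h 1 (fun k : R => rho (x + k *: v)) (derive rho (x + h *: v) v).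
Proof.
have E : (fun k : R => k^-1 *: (rho (x + (k *: 1 + h) *: v) - rho (x + h *: v))) =
   (fun k : R => k^-1 *: (rho (k *: v + (x + h *: v)) - rho (x + h *: v))).
  apply/funext => k; congr (_ *: (rho _ - _)).
  have -> : k *: (1 : R) = k by exact: mulr1.
  by rewrite scalerDl addrCA.
apply: DeriveDef.
  by rewrite /derivable /= E; exact: smooth_derivable.
by rewrite /derive /= E.
Qed.

Lemma line_mean_value x v (h : R) : 0 < h ->
  exists2 c : R, 0 < c < h & rho (x + h *: v) - rho x = h * derive rho (x + c *: v) v.
Proof.
move=> h0; have [||c] := @MVT R (fun k => rho (x + k *: v)) (fun k => derive rho (x + k *: v) v) 0 h h0.
- by move=> k _; exact: is_derive_line.
- apply: derivable_within_continuous => k _.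
  by case: (is_derive_line x v k).
rewrite in_itv/= scale0r addr0 subr0 mulrC => ch E; exists c => //.
Qed.

Lemma derive_near x v (e : R) : 0 < e -> exists2 r : R, 0 < r &
  forall y, enorm (y - x) < r -> `|derive rho x v - derive rho y v| < e.
Proof. by move=> e0; have /continuous_eballP := @smooth_derive_continuous v; apply. Qed.

(** The mean value theorem is applied on the direct path from [x] to [x + h (v + w)] and on the path
    through [x + h w]. With [h = r / S] the three intermediate points lie within [r] of [x], where
    continuity makes the derivatives close to those at [x]. *)
Lemma deriveDv x v w : derive rho x (v + w) = derive rho x v + derive rho x w.
Proof.
apply/eqP; rewrite -subr_eq0 -normr_le0; apply/ler_addgt0Pr => e e0; rewrite add0r.
have e3 : 0 < e / 3 by lra.
have [r1 r10 H1] := derive_near x (v + w) e3.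
have [r2 r20 H2] := derive_near x v e3.
have [r3 r30 H3] := derive_near x w e3.
pose r := Num.min r1 (Num.min r2 r3).
have r0 : 0 < r by rewrite !lt_min r10 r20.
pose S := enorm v + enorm w + enorm (v + w) + 1.
have S0 : 0 < S by rewrite ltr_wpDl// !addr_ge0// enorm_ge0.
pose h := r / S; have h0 : 0 < h by rewrite divr_gt0.
have [c1 /andP[c10 c1h] E1] := line_mean_value x (v + w) h0.
have [c2 /andP[c20 c2h] E2] := line_mean_value (x + h *: w) v h0.
have [c3 /andP[c30 c3h] E3] := line_mean_value x w h0.
have hS : h * S = r by rewrite /h divfK// gt_eqF.
have B (c : R) (u : 'rV[R]_N) : 0 < c -> c < h -> 0 <= enorm u -> enorm (c *: u) <= h * enorm u.
  by move=> c0 ch u0; rewrite enormZ gtr0_norm// ler_wpM2r// ltW.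
have rr1 : r <= r1 by rewrite ge_min lexx.
have rr2 : r <= r2 by rewrite !ge_min lexx orbT.
have rr3 : r <= r3 by rewrite !ge_min lexx !orbT.
have ev := enorm_ge0 v; have ew := enorm_ge0 w; have evw := enorm_ge0 (v + w).
have hv := mulr_ge0 (ltW h0) ev; have hw := mulr_ge0 (ltW h0) ew.
have hvw := mulr_ge0 (ltW h0) evw.
have hS' : h * enorm v + h * enorm w + h * enorm (v + w) + h = r by rewrite -hS /S !mulrDr mulr1.
have /H1 K1 : enorm (x + c1 *: (v + w) - x) < r1.
  by rewrite addrAC subrr add0r; have := B c1 (v + w) c10 c1h evw; lra.
have /H2 K2 : enorm (x + h *: w + c2 *: v - x) < r2.
  have -> : x + h *: w + c2 *: v - x = h *: w + c2 *: v.
    by apply/eqP; rewrite subr_eq -addrA addrC.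
  apply: le_lt_trans (ler_enormD _ _) _.
  by rewrite enormZ gtr0_norm//; have := B c2 v c20 c2h ev; lra.
have /H3 K3 : enorm (x + c3 *: w - x) < r3.
  by rewrite addrAC subrr add0r; have := B c3 w c30 c3h ew; lra.
have E : derive rho (x + c1 *: (v + w)) (v + w) =
  derive rho (x + h *: w + c2 *: v) v + derive rho (x + c3 *: w) w.
  apply: (mulfI (lt0r_neq0 h0)); rewrite mulrDr -E1 -E2 -E3 scalerDr (addrC (h *: v)) addrA.
  ring.
move: K1 K2 K3; rewrite !ltr_norml => /andP[? ?] /andP[? ?] /andP[? ?].
by rewrite ler_norml; apply/andP; split; lra.
Qed.

Lemma derive0v x : derive rho x 0 = 0.
Proof. by have := deriveDv x 0 0; rewrite addr0 => H; lra. Qed.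

Lemma deriveNv x v : derive rho x (- v) = - derive rho x v.
Proof. by have := deriveDv x v (- v); rewrite subrr derive0v => H; lra. Qed.

(** For [b > 0], a step [h] along [b v] and a step [h b] along [v] have the same endpoint; the mean
    value theorem on both and continuity at [x] conclude. *)
Lemma deriveZv x (a : R) v : derive rho x (a *: v) = a * derive rho x v.
Proof.
suff pos b : 0 < b -> derive rho x (b *: v) = b * derive rho x v.
  have [a0|a0|->] := ltgtP a 0; last 2 first.
  - exact: pos.
  - by rewrite scale0r derive0v mul0r.
  by rewrite -[in LHS](opprK a) scaleNr deriveNv pos ?oppr_gt0// mulNr opprK.
move=> b0; apply/eqP; rewrite -subr_eq0 -normr_le0; apply/ler_addgt0Pr => e e0.
rewrite add0r; have e2 : 0 < e / 2 by lra.
have eb : 0 < e / 2 / b by rewrite divr_gt0.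
have [r1 r10 H1] := derive_near x (b *: v) e2.
have [r2 r20 H2] := derive_near x v eb.
pose r := Num.min r1 r2; have r0 : 0 < r by rewrite lt_min r10.
pose S := b * enorm v + 1.
have bv : 0 <= b * enorm v by rewrite mulr_ge0 ?enorm_ge0// ltW.
have S0 : 0 < S by rewrite ltr_wpDl.
pose h := r / S; have h0 : 0 < h by rewrite divr_gt0.
have hS : h * S = r by rewrite /h divfK// gt_eqF.
have hS' : h * (b * enorm v) + h = r by rewrite -hS /S mulrDr mulr1.
have [c1 /andP[c10 c1h] E1] := line_mean_value x (b *: v) h0.
have hb0 : 0 < h * b by rewrite mulr_gt0.
have [c2 /andP[c20 c2h] E2] := line_mean_value x v hb0.
have rr1 : r <= r1 by rewrite ge_min lexx.
have rr2 : r <= r2 by rewrite ge_min lexx orbT.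
have /H1 K1 : enorm (x + c1 *: (b *: v) - x) < r1.
  rewrite addrAC subrr add0r !enormZ !gtr0_norm//.
  by have := ler_wpM2r bv (ltW c1h); lra.
have /H2 K2 : enorm (x + c2 *: v - x) < r2.
  rewrite addrAC subrr add0r enormZ gtr0_norm//.
  by have := ler_wpM2r (enorm_ge0 v) (ltW c2h); rewrite -mulrA; lra.
have E : derive rho (x + c1 *: (b *: v)) (b *: v) = b * derive rho (x + c2 *: v) v.
  by apply: (mulfI (lt0r_neq0 h0)); rewrite -E1 mulrA -E2 scalerA.
have K3 : `|b * derive rho x v - b * derive rho (x + c2 *: v) v| < e / 2.
  rewrite -mulrBr normrM gtr0_norm//; move: K2; rewrite ltr_pdivlMr// mulrC//.
move: K1 K3; rewrite E !ltr_norml => /andP[? ?] /andP[? ?].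
by rewrite ler_norml; apply/andP; split; lra.
Qed.

Lemma derive_dot_grad x v : derive rho x v = dot (grad rho x) v.
Proof.
rewrite {1}(row_sum_delta v) /dot.
under eq_bigr => i _ do rewrite -[X in X *: _]/(v ord0 i).
elim/big_ind2 : _ => [|a b a' b' <- <-|i _]; first exact: derive0v.
- exact: deriveDv.
- by rewrite deriveZv mxE mulrC.
Qed.

Lemma derive_gt0_right x v : rho x = 0 -> 0 < derive rho x v ->
  exists2 r : R, 0 < r & forall h, 0 < h < r -> 0 < rho (x + h *: v).
Proof.
move=> rx Dv; have [r r0 H] := derive_near x v Dv.
have e1 : 0 < enorm v + 1 by rewrite ltr_wpDl// enorm_ge0.
exists (r / (enorm v + 1)); first by rewrite divr_gt0.
move=> h /andP[h0 hr]; have [c /andP[c0 ch]] := line_mean_value x v h0.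
rewrite rx subr0 => ->; rewrite mulr_gt0//.
have /H : enorm (x + c *: v - x) < r.
  rewrite addrAC subrr add0r enormZ gtr0_norm//.
  rewrite ltr_pdivlMr// in hr.
  have := ler_wpM2r (enorm_ge0 v) (ltW ch); have := enorm_ge0 v; lra.
by rewrite ltr_norml => /andP[? ?]; lra.
Qed.

Lemma derive_lt0_right x v : rho x = 0 -> derive rho x v < 0 ->
  exists2 r : R, 0 < r & forall h, 0 < h < r -> rho (x + h *: v) < 0.
Proof.
move=> rx Dv; have Dv' : 0 < - derive rho x v by lra.
have [r r0 H] := derive_near x v Dv'.
have e1 : 0 < enorm v + 1 by rewrite ltr_wpDl// enorm_ge0.
exists (r / (enorm v + 1)); first by rewrite divr_gt0.
move=> h /andP[h0 hr]; have [c /andP[c0 ch]] := line_mean_value x v h0.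
rewrite rx subr0 => ->; rewrite pmulr_rlt0//.
have /H : enorm (x + c *: v - x) < r.
  rewrite addrAC subrr add0r enormZ gtr0_norm//.
  rewrite ltr_pdivlMr// in hr.
  have := ler_wpM2r (enorm_ge0 v) (ltW ch); have := enorm_ge0 v; lra.
by rewrite ltr_norml => /andP[? ?]; lra.
Qed.

End DirectionalDerivative.


(** * Normal coordinates as nearest-point projection *)

Section NormalCoordinates.
Context {R : realType} {N : nat} (Om : set 'rV[R]_N) (rho : 'rV[R]_N -> R) (s0 : R).
Hypotheses (Om_bounded : exists M : R, forall x, Om x -> enorm x <= M) (Om0 : Om !=set0).
Hypothesis rhoOm : defining_function Om rho.
Hypothesis coords : normal_coordinates Om (ext_normal rho) s0.
Notation K := (closure Om).
Notation eta := (ext_normal rho).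
Notation ncoord y z s := (normal_coord Om eta s0 y (z, s)).

Let smooth_rho : smooth rho. Proof. by case: rhoOm. Qed.
Let OmE : Om = [set x | rho x < 0]. Proof. by case: rhoOm => _ []. Qed.

Lemma compact_closure_dom : compact K.
Proof. by have [M OmM] := Om_bounded; exact: closure_compact OmM. Qed.

Lemma closure_dom_nonempty : K !=set0.
Proof. by have [x Omx] := Om0; exists x; exact: subset_closure. Qed.

Lemma closure_dom_le0 x : K x -> rho x <= 0.
Proof.
move=> Kx; rewrite leNgt; apply/negP => rx.
have /continuous_eballP/(_ x _ rx)[r r0 H] := smooth_continuous smooth_rho.
have /closure_eballP/(_ r r0)[y] := Kx; rewrite OmE /= => ry yx.
by have := H y yx; rewrite ltr_norml => /andP[? ?]; lra.
Qed.

Lemma open_dom x : Om x -> exists2 r : R, 0 < r & forall y, enorm (y - x) < r -> Om y.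
Proof.
rewrite OmE /= => rx; have rx' : 0 < - rho x by lra.
have /continuous_eballP/(_ x _ rx')[r r0 H] := smooth_continuous smooth_rho.
by exists r => // y /H; rewrite ltr_norml => /andP[? ?]; lra.
Qed.

Lemma bdry_dom_closure z : bdry Om z -> K z.
Proof. by case. Qed.

Lemma bdry_dom_eq0 z : bdry Om z -> rho z = 0.
Proof.
move=> [Kz nI]; apply/eqP; rewrite eq_le closure_dom_le0//= leNgt; apply/negP => rz.
have [|r r0 H] := @open_dom z; first by rewrite OmE.
by apply: nI; apply/nbhs_eballP; exists r.
Qed.

Lemma dot_grad_gt0 z : bdry Om z -> 0 < dot (grad rho z) (grad rho z).
Proof.
by move=> /bdry_dom_eq0 rz; rewrite -sqr_enorm exprn_gt0// enorm_gt0; case: rhoOm => _ [_]; apply.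
Qed.

Lemma ext_normal_unit z : bdry Om z -> enorm (eta z) = 1.
Proof.
move=> bz; rewrite /ext_normal enormZ ger0_norm ?invr_ge0 ?enorm_ge0// mulVf//.
by rewrite -sqrf_eq0 sqr_enorm gt_eqF// dot_grad_gt0.
Qed.

(** From an interior point a short move towards [y] stays in the domain and reduces the distance. *)
Lemma nearest_in_bdry y z : ~ K y -> K z -> (forall x, K x -> enorm (y - z) <= enorm (y - x)) ->
  bdry Om z.
Proof.
move=> Ky Kz zmin; split => // Iz.
have [r r0 H] : exists2 r : R, 0 < r & forall x, enorm (x - z) < r -> Om x.
  by move: Iz => /nbhs_eballP.
have yz : 0 < enorm (y - z).
  by rewrite enorm_gt0 subr_eq0; apply: contra_notN Ky => /eqP ->.
pose t := Num.min (1 / 2) (r / (enorm (y - z) + 1)).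
have t0 : 0 < t by rewrite lt_min divr_gt0//= divr_gt0// addr_gt0.
have t1 : t < 1 by rewrite gt_min; apply/orP; left; lra.
have /subset_closure/zmin : Om (z + t *: (y - z)).
  apply: H; rewrite addrAC subrr add0r enormZ gtr0_norm//.
  have : t <= r / (enorm (y - z) + 1) by rewrite ge_min lexx orbT.
  by rewrite ler_pdivlMr ?addr_gt0//; lra.
have -> : y - (z + t *: (y - z)) = (1 - t) *: (y - z).
  by rewrite scalerBl scale1r opprD addrA.
by rewrite enormZ gtr0_norm ?subr_gt0//; nra.
Qed.

(* First-order optimality: every direction entering the domain makes an
   obtuse angle with [y - z], so [y - z] is a nonnegative multiple of the gradient. *)
Lemma nearest_normal y z : ~ K y -> K z -> (forall x, K x -> enorm (y - z) <= enorm (y - x)) ->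
  y = z + enorm (y - z) *: eta z.
Proof.
move=> Ky Kz zmin; have bz := nearest_in_bdry Ky Kz zmin.
have [w wE] : exists w, w = y - z by exists (y - z).
have [g gE] : exists g, g = grad rho z by exists (grad rho z).
have g0 : 0 < dot g g by rewrite gE dot_grad_gt0.
(* Moving by [h v] into the domain cannot reduce the distance, so [2 w.v <= h v.v]; then [h] tends
   to 0. *)
have obtuse v : dot g v < 0 -> dot w v <= 0.
  rewrite gE -derive_dot_grad// => Dv.
  have [r r0 H] := derive_lt0_right smooth_rho (bdry_dom_eq0 bz) Dv.
  apply/ler_addgt0Pr => e e0; rewrite add0r.
  pose h := Num.min (r / 2) (e / (dot v v + 1)).
  have v1 : 0 < dot v v + 1 by rewrite ltr_wpDl// dot_ge0.
  have h0 : 0 < h by rewrite lt_min !divr_gt0.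
  have hr : h < r by rewrite gt_min; apply/orP; left; lra.
  have : Om (z + h *: v) by rewrite OmE; apply: H; rewrite h0.
  move/subset_closure/zmin.
  rewrite -(@ler_pXn2r _ 2) ?nnegrE ?enorm_ge0// !sqr_enorm opprD addrA -wE !dotE (dotC v).
  have : h <= e / (dot v v + 1) by rewrite ge_min lexx orbT.
  rewrite ler_pdivlMr// => he; have vv := dot_ge0 v.
  move=> H'; have {H'} : h * (2 * dot w v - h * dot v v) <= 0 by lra.
  by rewrite pmulr_rle0//; nra.
pose a := dot w g / dot g g.
have ag : a * dot g g = dot w g by rewrite /a divfK// gt_eqF.
have a0 : 0 <= a.
  rewrite divr_ge0 ?(ltW g0)//.
  by have := @obtuse (- g); rewrite !dotE oppr_lt0 g0 => /(_ isT); lra.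
have wa : w = a *: g.
  apply/eqP; rewrite -subr_eq0 -enorm_eq0 -sqrf_eq0 sqr_enorm eq_le dot_ge0 andbT.
  apply/ler_addgt0Pr => e e0; rewrite add0r.
  have c0 : 0 < a * dot g g + 1 by rewrite ltr_wpDl// mulr_ge0// ltW.
  pose b := e / (a * dot g g + 1); have b0 : 0 < b by rewrite divr_gt0.
  have be : b * (a * dot g g) + b = e by rewrite /b; field; rewrite gt_eqF.
  have gb : 0 < b * dot g g by rewrite mulr_gt0.
  (* The component of [w] orthogonal to [g] is tilted by [- b g] to enter the domain strictly;
     letting [b] tend to 0 shows that this component vanishes. *)
  have := @obtuse (w - a *: g - b *: g); rewrite !dotE (dotC g w) -ag.
  have -> : a * dot g g + - (a * dot g g) + - (b * dot g g) = - (b * dot g g) by ring.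
  rewrite oppr_lt0 => /(_ gb); lra.
have e0 : enorm g != 0 by rewrite -sqrf_eq0 sqr_enorm gt_eqF.
rewrite /ext_normal -gE -wE scalerA {1}wa enormZ ger0_norm// -mulrA divff// mulr1.
by rewrite -wa wE addrC subrK.
Qed.

Lemma nearest_normal_coord y z : ~ K y -> K z ->
  (forall x, K x -> enorm (y - z) <= enorm (y - x)) -> enorm (y - z) < s0 ->
  ncoord y z (enorm (y - z)).
Proof.
move=> Ky Kz zmin ys; split => /=; first exact: nearest_in_bdry Ky Kz zmin.
split; last exact: nearest_normal.
rewrite ys andbT enorm_gt0 subr_eq0.
by apply: contra_notN Ky => /eqP ->.
Qed.

Lemma normal_coord_inj y z s z' s' : ncoord y z s -> ncoord y z' s' -> z = z' /\ s = s'.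
Proof. by case: coords => U _ /U H /H [-> ->]. Qed.

Let P y := projT1 (cid2 (nearest_point y compact_closure_dom closure_dom_nonempty)).

Let PK y : K (P y). Proof. by rewrite /P; case: cid2. Qed.
Arguments PK : clear implicits.

Let Pmin y x : K x -> enorm (y - P y) <= enorm (y - x).
Proof. by rewrite /P; case: cid2 => /= z Kz H; exact: H. Qed.

Let delta y := enorm (y - P y).

Let delta_gt0 y : ~ K y -> 0 < delta y.
Proof.
move=> Ky; rewrite /delta enorm_gt0 subr_eq0.
by apply: contra_notN Ky => /eqP ->; exact: PK.
Qed.

Let delta_continuous : continuous delta.
Proof.
apply/continuous_eballP => x e e0; exists e => // y yx.
have := Pmin x (PK y); have := Pmin y (PK x).
have := ler_enorm_dist x y (P y); have := ler_enorm_dist y x (P x).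
rewrite -!/(delta _) (enormC x y) ltr_norml.
move: (delta x) (delta y) (enorm (x - P y)) (enorm (y - P x)) (enorm (y - x)) yx.
by move=> a b c f g *; apply/andP; split; lra.
Qed.

Lemma normal_coord_dist y z s : ncoord y z s -> enorm (y - z) = s.
Proof.
move=> [/= bz [/andP[s1 _] ->]].
by rewrite addrAC subrr add0r enormZ ext_normal_unit// mulr1 gtr0_norm.
Qed.

(* Uniqueness forces the distance to the domain at [z + r eta z] to be 0 or [r];
   it is [r] for small [r], and it never takes the value [r / 2]. *)
Lemma normal_coord_nearest y z s x : ncoord y z s -> K x -> s <= enorm (y - x).
Proof.
move=> c; move: (c) => [/= bz [/andP[s1 ss0] yE]] Kx.
have onray r : 0 < r -> r <= s -> ncoord (z + r *: eta z) z r.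
  by move=> r0 rs; split => //=; split => //; rewrite r0/=; exact: le_lt_trans rs ss0.
(* The nearest point provides a second pair of coordinates of the same point, so uniqueness
   identifies the distance with [r]. *)
have ray_dist r : 0 < r -> r <= s -> 0 < delta (z + r *: eta z) -> delta (z + r *: eta z) < s0 ->
    delta (z + r *: eta z) = r.
  move=> r0 rs d0 ds.
  have nK : ~ K (z + r *: eta z).
    by move=> Kr; have := Pmin (z + r *: eta z) Kr; rewrite subrr enorm0 -/(delta _) leNgt d0.
  exact: (normal_coord_inj (nearest_normal_coord nK (PK _) (@Pmin _) ds) (onray r r0 rs)).2.
have le_ray r : 0 < r -> r <= s -> delta (z + r *: eta z) < s0.
  move=> r0 rs; apply: le_lt_trans (Pmin _ (bdry_dom_closure bz)) _.
  by rewrite (normal_coord_dist (onray r r0 rs)); exact: le_lt_trans rs ss0.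
have [r1 [r10 r1s nK1]] : exists r : R, [/\ 0 < r, r < s & ~ K (z + r *: eta z)].
  have Dg : 0 < derive rho z (eta z).
    rewrite derive_dot_grad// dotZr mulr_gt0 ?dot_grad_gt0// invr_gt0 enorm_gt0.
    by case: rhoOm => _ [_]; apply; exact: bdry_dom_eq0.
  have [r r0 H] := derive_gt0_right smooth_rho (bdry_dom_eq0 bz) Dg.
  have m0 : 0 < Num.min r s by rewrite lt_min r0.
  have mr : Num.min r s <= r by rewrite ge_min lexx.
  have ms : Num.min r s <= s by rewrite ge_min lexx orbT.
  exists (Num.min r s / 2); split; [lra|lra|] => /closure_dom_le0.
  by rewrite leNgt H//; apply/andP; split; lra.
suff ds : 0 < delta y.
  have := Pmin y Kx; rewrite -/(delta y).
  by rewrite {1}yE ray_dist// -yE//; rewrite yE; exact: le_ray.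
rewrite lt_def enorm_ge0 andbT; apply/negP => /eqP dy0.
pose f r := delta (z + r *: eta z) - r / 2.
have r1E := ray_dist _ r10 (ltW r1s) (delta_gt0 nK1) (le_ray _ r10 (ltW r1s)).
have fr1 : f r1 = r1 / 2 by rewrite /f r1E; lra.
have fs : f s = - (s / 2) by rewrite /f -yE dy0 add0r.
have [||r] := @IVT _ f r1 s 0 (ltW r1s).
- apply: continuous_subspaceT => r.
  apply: (@continuousB _ _ _ (fun r : R => delta (z + r *: eta z)) (fun r : R => r / 2)).
    apply: (@continuous_comp _ _ _ (fun r : R => z + r *: eta z) delta); last exact: delta_continuous.
    by apply: cvgD; [exact: cvg_cst|apply: cvgZr_tmp; exact: cvg_id].
  by apply: cvgM; [exact: cvg_id|exact: cvg_cst].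
- by rewrite fr1 fs ge_min le_max; apply/andP; split; apply/orP; [right|left]; lra.
rewrite in_itv/= => /andP[r1r rs] fr.
have r0 : 0 < r by lra.
have dr : delta (z + r *: eta z) = r / 2 by exact: subr0_eq fr.
have r20 : 0 < r / 2 by rewrite divr_gt0.
have := ray_dist r r0 rs; rewrite dr => /(_ r20).
have := le_ray r r0 rs; rewrite dr => L /(_ L) E.
have : r / 2 < r by rewrite ltr_pdivrMr// ltr_pMr// ltr1n.
by rewrite E ltxx.
Qed.

(** The hypothesis on coordinates excludes points of [Om]; boundary points are excluded because [s]
    is a positive lower bound for the distance to the closure. *)
Lemma closure_no_normal_coord y z s : K y -> ~ ncoord y z s.
Proof.
move=> Ky c; have := normal_coord_nearest c Ky; rewrite subrr enorm0.
by case: c => /= _ [/andP[? _] _]; lra.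
Qed.

(** The nearest point supplies the coordinates, at every exterior point within [s0] of the
    closure. *)
Lemma normal_coord_exists y x : ~ K y -> K x -> enorm (y - x) < s0 ->
  exists z s, ncoord y z s.
Proof.
move=> Ky Kx yx; exists (P y), (delta y).
exact: (nearest_normal_coord Ky (PK y) (@Pmin y) (le_lt_trans (Pmin y Kx) yx)).
Qed.

Lemma ubar_normal_coord (u : 'rV[R]_N -> R -> R) y z s t : ncoord y z s ->
  ubar Om eta s0 u y t = u z t.
Proof.
move=> c; rewrite /ubar; case: pselect => [h|]; last by case; exists (z, s).
case: (cid h) => -[z' s'] /= c'.
by have [->] := normal_coord_inj c c'.
Qed.

Lemma ubar_no_normal_coord (u : 'rV[R]_N -> R -> R) y t :
  (forall z s, ~ ncoord y z s) -> ubar Om eta s0 u y t = 0.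
Proof.
move=> H; rewrite /ubar; case: pselect => // -[[z s] c].
by case: (H z s).
Qed.

(* The exterior ball of radius [r] touching at [z] gives the one-sided bound. *)
Lemma dot_ext_normal_le z x r : bdry Om z -> K x -> 0 < r < s0 ->
  2 * r * dot (eta z) (x - z) <= dot (x - z) (x - z).
Proof.
move=> bz Kx rs; have c : ncoord (z + r *: eta z) z r by split.
have H := normal_coord_nearest c Kx; case/andP: rs => r0 _.
have u1 : dot (eta z) (eta z) = 1 by rewrite -sqr_enorm ext_normal_unit// expr1n.
rewrite -(@ler_pXn2r _ 2) ?nnegrE ?enorm_ge0 ?(ltW r0)// sqr_enorm in H.
rewrite (_ : z + r *: eta z - x = r *: eta z - (x - z)) in H; last first.
  by rewrite opprB addrCA addrA.
move: (x - z) (eta z) u1 H => X e u1; rewrite !dotE u1 (dotC X e) expr2; lra.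
Qed.

(** Take the inner product of [y - y'] with [z - z']. The exterior balls of radius [r] and
    [s, s' <= r / 2] make each normal term cost at most a quarter of the squared length of [z - z'];
    half of it remains, whence the factor 2. *)
Lemma foot_lipschitz y z s y' z' s' r : 0 < r < s0 -> ncoord y z s -> ncoord y' z' s' ->
  s <= r / 2 -> s' <= r / 2 -> enorm (z - z') <= 2 * enorm (y - y').
Proof.
move=> rs c c' sr sr'.
have := dot_le_enorm (y - y') (z - z').
case: c c' => /= bz [/andP[sp _] ->] [/= bz' [/andP[sp' _] ->]].
have H1 := dot_ext_normal_le bz (bdry_dom_closure bz') rs.
have H2 := dot_ext_normal_le bz' (bdry_dom_closure bz) rs.
set Y := (X in enorm X * _).
have -> : dot Y (z - z') = dot (z - z') (z - z') - s * dot (eta z) (z' - z) - s' * dot (eta z') (z - z').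
  rewrite /Y (_ : _ - _ = (z - z') + s *: eta z - s' *: eta z'); last first.
    by rewrite opprD addrACA addrA.
  by rewrite 2!dotDl dotNl !dotZl -(opprB z z') dotNr; ring.
have [->|zz'] := eqVneq (enorm (z - z')) 0; first by rewrite mulr_ge0// enorm_ge0.
have zp : 0 < enorm (z - z') by rewrite lt_def zz' enorm_ge0.
have E : dot (z' - z) (z' - z) = dot (z - z') (z - z').
  by rewrite -(opprB z z') dotNl dotNr opprK.
rewrite E in H1; case/andP: rs => r0 _.
have Dp := dot_ge0 (z - z').
have A1 : s * dot (eta z) (z' - z) <= dot (z - z') (z - z') / 4.
  have [/(mulr_ge0_le0 (ltW sp))|/ltW q] := leP (dot (eta z) (z' - z)) 0; first lra.
  by have := ler_wpM2r q sr; lra.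
have A2 : s' * dot (eta z') (z - z') <= dot (z - z') (z - z') / 4.
  have [/(mulr_ge0_le0 (ltW sp'))|/ltW q] := leP (dot (eta z') (z - z')) 0; first lra.
  by have := ler_wpM2r q sr'; lra.
move=> H; have {H} : enorm (z - z') * (enorm (z - z') / 2) <= enorm (z - z') * enorm Y.
  have -> : enorm (z - z') * (enorm (z - z') / 2) = dot (z - z') (z - z') / 2.
    by rewrite mulrA -expr2 sqr_enorm.
  rewrite [leRHS]mulrC; lra.
by rewrite ler_pM2l//; lra.
Qed.

(* Monotonicity of the nearest-point map makes [(1 - th) P + th id] expand by at least [th]. *)
Lemma contraction_to_foot_expands y z s y' z' s' (th : R) : ncoord y z s -> ncoord y' z' s' ->
  0 < th <= 1 -> th * enorm (y - y') <= enorm (z + (th * s) *: eta z - (z' + (th * s') *: eta z')).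
Proof.
move=> c c' /andP[th0 th1].
have m1 := normal_coord_nearest c (bdry_dom_closure (proj1 c')).
have m2 := normal_coord_nearest c' (bdry_dom_closure (proj1 c)).
rewrite /= -(normal_coord_dist c) -(@ler_pXn2r _ 2) ?nnegrE ?enorm_ge0// !sqr_enorm in m1.
rewrite /= -(normal_coord_dist c') -(@ler_pXn2r _ 2) ?nnegrE ?enorm_ge0// !sqr_enorm in m2.
(* The sum of the two minimality inequalities [m1] and [m2]. *)
have mono : 0 <= dot (z - z') (y - y').
  by move: m1 m2; rewrite !dotE (dotC y z) (dotC y z') (dotC y' z) (dotC y' z'); lra.
have E : z + (th * s) *: eta z - (z' + (th * s') *: eta z') = (1 - th) *: (z - z') + th *: (y - y').
  have -> : (th * s) *: eta z = th *: (y - z).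
    by case: c => /= _ [_ ->]; rewrite addrAC subrr add0r scalerA.
  have -> : (th * s') *: eta z' = th *: (y' - z').
    by case: c' => /= _ [_ ->]; rewrite addrAC subrr add0r scalerA.
  by apply/rowP => i; rewrite !mxE; ring.
rewrite E; set W := _ *: _ + _.
have := dot_le_enorm W (y - y').
have : th * dot (y - y') (y - y') <= dot W (y - y').
  by rewrite [leRHS]dotDl !dotZl lerDr mulr_ge0// subr_ge0.
rewrite -sqr_enorm expr2 mulrA => a b; have {a b} := le_trans a b.
have [->|yy] := eqVneq (enorm (y - y')) 0; first by rewrite !mulr0 => _; exact: enorm_ge0.
by rewrite ler_pM2r// lt_def yy enorm_ge0.
Qed.

End NormalCoordinates.


(** * Comparison of exterior integrals at different points *)

Lemma exists_near_sup (R : realType) (E : set R) (M e : R) : E !=set0 ->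
  (forall x, E x -> x <= M) -> 0 < e -> exists2 x, E x & forall y, E y -> y <= x + e.
Proof.
move=> E0 EM e0; have hs : has_sup E by split => //; exists M => x /EM.
have [x Ex xs] := sup_adherent e0 hs.
by exists x => // y Ey; have /(_ _ Ey) := sup_upper_bound hs; lra.
Qed.

Lemma within_continuous_eballP (R : realType) N (A : set 'rV[R]_N) (f : 'rV[R]_N -> R) :
  {within A, continuous f} <-> forall x, A x -> forall e : R, 0 < e ->
  exists2 r : R, 0 < r & forall y, A y -> enorm (y - x) < r -> `|f x - f y| < e.
Proof.
rewrite subspace_continuousP; split=> H x Ax => [e e0|].
  have /(@cvgrPdist_lt _ _ _ (within A (nbhs x)))/(_ e e0) := H x Ax.
  rewrite near_withinE => /nbhs_eballP[r r0 rP].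
  by exists r => // y Ay yx; exact: rP.
apply/(@cvgrPdist_lt _ _ _ (within A (nbhs x))) => e e0.
have [r r0 rP] := H x Ax e e0.
by rewrite near_withinE; apply/nbhs_eballP; exists r => // y yx Ay; exact: rP.
Qed.

(** At 0 the modulus is explicit; at positive points differentiability gives it. *)
Lemma powR_continuous_ge0 (R : realType) (p a e : R) : 0 < p -> 0 <= a -> 0 < e ->
  exists2 r : R, 0 < r & forall b, 0 <= b -> `|a - b| < r -> `|a `^ p - b `^ p| < e.
Proof.
move=> p0; rewrite le_eqVlt => /predU1P[<-|a0] e0.
  exists (e `^ p^-1); first exact: powR_gt0.
  move=> b b0; rewrite powR0 ?gt_eqF// !sub0r !normrN !ger0_norm ?powR_ge0// => be.
  have -> : e = (e `^ p^-1) `^ p by rewrite -powRrM mulVf ?powRr1 ?gt_eqF// ltW.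
  by apply: gt0_ltr_powR => //; rewrite nnegrE ?powR_ge0.
have /derivable1_diffP/differentiable_continuous/cvgrPdist_lt/(_ e e0) :
    derivable (fun b : R => b `^ p) a 1 by apply: derivable_powR; rewrite in_itv/= a0.
by move=> /nbhs_normP[r /= r0 rP]; exists r => // b _ ab; exact: rP.
Qed.

Lemma within_continuous_powR (R : realType) N (A : set 'rV[R]_N) (v : 'rV[R]_N -> R) (p : R) :
  0 < p -> {within A, continuous v} -> (forall x, A x -> 0 <= v x) ->
  {within A, continuous (fun x => v x `^ p)}.
Proof.
move=> p0 /within_continuous_eballP cv v0; apply/within_continuous_eballP => x Ax e e0.
have [r r0 rP] := powR_continuous_ge0 p0 (v0 _ Ax) e0.
have [r' r'0 r'P] := cv x Ax r r0.
by exists r' => // y Ay yx; apply: rP; [exact: v0|exact: r'P].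
Qed.

Lemma addrr_le_mul2 (R : realType) (x : R) : x + x <= 2 * x.
Proof. lra. Qed.

(** Origin of the constant 18. Here [n] stands for [N h] and [Rh] for [(N + 1) h]. Shifted corners
    of two overlapping cubes are within [2 n]; undoing the normal shift adds [2 Rh], undoing the
    contraction by 1/4 multiplies by 4, and returning to grid corners adds [2 n]: in all less than
    [4 * 4 + 2] times [Rh]. *)
Lemma overlap_arith (R : realType) (h n Rh yy X ww D1 D2 gg gy G1 G2 : R) :
  0 < h -> n < Rh -> 1 / 4 * yy <= X -> X <= ww + 2 * Rh -> ww <= D1 + D2 ->
  D1 <= n -> D2 <= n -> gg <= G1 + gy -> gy <= yy + G2 -> G1 <= n -> G2 <= n ->
  gg < 18%:R * Rh + h.
Proof. lra. Qed.

Section OuterIntegral.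
Context {R : realType} {N : nat} (Om : set 'rV[R]_N) (rho : 'rV[R]_N -> R) (s0 : R).
Hypotheses (Om_bounded : exists M : R, forall x, Om x -> enorm x <= M) (Om0 : Om !=set0).
Hypothesis rhoOm : defining_function Om rho.
Hypothesis coords : normal_coordinates Om (ext_normal rho) s0.
Context (J : 'rV[R]_N -> R) (d p : R).
Hypotheses (cJ : continuous J) (J0 : forall x, 0 <= J x).
Hypotheses (d0 : 0 < d) (ds0 : d < s0) (p1 : 1 < p).
Hypotheses (Jpos : forall x, enorm x < d -> 0 < J x) (Jd : forall x, d <= enorm x -> J x = 0).
Notation K := (closure Om).
Notation eta := (ext_normal rho).
Notation ncoord y z s := (normal_coord Om eta s0 y (z, s)).

Definition outer_density (u : 'rV[R]_N -> R -> R) (t : R) (x y : 'rV[R]_N) : R :=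
  \1_(~` Om) y * (J (x - y) * (ubar Om eta s0 u y t) `^ p).

Definition outer u t x : R := iint (outer_density u t x).

Lemma outer_density_ge0 u t x y : 0 <= outer_density u t x y.
Proof. by rewrite !mulr_ge0// ?powR_ge0// indicE. Qed.

Lemma outer_ge0 u t x : 0 <= outer u t x.
Proof. by apply: iint_ge0 => y; exact: outer_density_ge0. Qed.

Lemma outer_density_normal_coord u t x y z s : ncoord y z s ->
  outer_density u t x y = J (x - y) * (u z t) `^ p.
Proof.
move=> c; rewrite /outer_density (ubar_normal_coord coords _ _ c) indicE mem_set ?mul1r//.
by case: coords => _ [H _]; exact: H c.
Qed.

(** On the closure [ubar] takes its default value 0, and [0 ^ p = 0]. Off it, a point within
    [d < s0] of [x] has coordinates, with [s] at most its distance to [x]. *)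
Lemma outer_densityP u t x y : K x -> outer_density u t x y = 0 \/
  exists z s, [/\ ncoord y z s, s < d, enorm (y - x) < d &
    outer_density u t x y = J (x - y) * (u z t) `^ p].
Proof.
move=> Kx; have [xd|xd] := leP d (enorm (x - y)).
  by left; rewrite /outer_density Jd// mul0r mulr0.
rewrite enormC in xd.
have [Ky|Ky] := pselect (K y).
  left; rewrite /outer_density ubar_no_normal_coord ?powR0 ?mulr0//; first by rewrite gt_eqF// (lt_trans _ p1).
  by move=> z s; exact: closure_no_normal_coord.
right; have [z [s c]] := normal_coord_exists Om_bounded Om0 rhoOm Ky Kx (lt_trans xd ds0).
have sd := le_lt_trans (normal_coord_nearest Om_bounded Om0 rhoOm coords c Kx) xd.
by exists z, s; split; [exact: c|exact: sd|exact: xd|exact: (outer_density_normal_coord _ _ _ c)].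
Qed.

Section FixedTime.
Context (u : 'rV[R]_N -> R -> R) (t : R).
Hypothesis cu : {within K, continuous (u ^~ t)}.
Hypothesis u0 : forall z, K z -> 0 <= u z t.

Let cw : {within K, continuous (fun z => u z t `^ p)}.
Proof. by apply: within_continuous_powR => //; exact: lt_trans p1. Qed.

Lemma outer_density_bounded x : K x ->
  exists A C : R, 0 <= A /\ box_bounded A C (outer_density u t x).
Proof.
move=> Kx; have [Jm Jm0 JJm] := kernel_bounded cJ J0 d0 Jd.
have [z0 Kz0 zmax] := @compact_EVT_max _ R _ K (ex_intro _ x Kx) (compact_closure_dom Om_bounded) cw.
exists (enorm x + d), (Jm * (u z0 t) `^ p); split; first by rewrite addr_ge0 ?enorm_ge0// ltW.
have Jw0 : 0 <= Jm * (u z0 t) `^ p by rewrite mulr_ge0 ?powR_ge0// ltW.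
split => [y|y i yi].
  rewrite outer_density_ge0/=.
  have [->//|[z [s [[/= bz _] _ _ ->]]]] := outer_densityP u t y Kx.
  by rewrite ler_pM ?powR_ge0// zmax// inE; exact: bdry_dom_closure bz.
rewrite /outer_density Jd ?mul0r ?mulr0//.
have := coord_le_enorm y i; have := enorm_dist_ge y x; rewrite (enormC y); lra.
Qed.

End FixedTime.

(* [outer] at any point is controlled by [outer] at one arbitrary boundary point
   per patch.  The strip of width [d] is discretised into cubes of side [h]; moving the
   representative [z + s eta] of a cube to [z + (s/4 + (N+1)h) eta] brings it within
   [3d/4] of the patch point, and by monotonicity of the nearest-point map the
   translated cubes overlap boundedly often. *)
Lemma outer_le_patches (u : 'rV[R]_N -> R -> R) (t : R) (net : seq 'rV[R]_N)
  (L : nat) (Jm j0 : R) (zc : 'rV[R]_N -> 'rV[R]_N) x :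
  {within K, continuous (u ^~ t)} -> (forall z, K z -> 0 <= u z t) ->
  (forall z, bdry Om z -> exists2 c, c \in net & enorm (z - c) < d / 8) ->
  L = (18 * N.+1)%N -> 0 < Jm -> (forall y, J y <= Jm) -> 0 < j0 ->
  (forall y, enorm y <= 3 / 4 * d -> j0 <= J y) ->
  (forall c, c \in net -> bdry Om (zc c) /\ enorm (zc c - c) < d / 8) -> K x ->
  outer u t x <= Jm * (((2 * L).+1 ^ N)%N%:R / j0) * \sum_(c <- net) outer u t (zc c).
Proof.
move=> cu u0 netP LE Jm0 JJm j00 Jj0 zcP Kx.
set m0 := ((2 * L).+1 ^ N)%N.
have m00 : 0 < m0%:R :> R by rewrite ltr0n expn_gt0.
pose w z := u z t `^ p.
have w0 z : 0 <= w z by exact: powR_ge0.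
have cw : {within K, continuous w}.
  by apply: within_continuous_powR => //; exact: lt_trans p1.
have [M OmM] := Om_bounded; have KM := closure_enorm_bounded OmM.
have M0 : 0 <= M by apply: le_trans (KM _ Kx); exact: enorm_ge0.
have cK := compact_closure_dom Om_bounded.
have [z0 Kz0 zmax] := @compact_EVT_max _ R w K (ex_intro _ x Kx) cK cw.
pose A := M + d + 1; have A0 : 0 < A by rewrite ltr_wpDl// addr_ge0// ltW.
(* [del] is the tolerance on [w], both for near-maximal representatives of cells and for moving the
   foot. *)
suff main del : 0 < del -> outer u t x <=
    Jm * (m0%:R / j0) * (\sum_(c <- net) outer u t (zc c)) + del * (2 * Jm * (A *+ 2) ^+ N).
  apply/ler_addgt0Pr => e e0.
  pose V := 2 * Jm * (A *+ 2) ^+ N.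
  have V0 : 0 <= V by rewrite !mulr_ge0 ?exprn_ge0 ?mulrn_wge0// ltW.
  have V1 : 0 < V + 1 by rewrite ltr_wpDl.
  apply: le_trans (main (e / (V + 1)) _) _; first by rewrite divr_gt0.
  by rewrite lerD2l -/V mulrAC ler_pdivrMr// ler_wpM2l ?(ltW e0)// lerDl.
move=> del0.
have [r r0 rP] := compact_unif_continuous cK cw del0.
have Rn0 : 0 < N.+1%:R :> R by [].
(* The first bound keeps feet within [r] after the factor 2 of the Lipschitz estimate; the second
   keeps shifts below [d / 8]. *)
have q0 : 0 < Num.min (r / (2 * N.+1%:R)) (d / (8 * N.+1%:R)) by rewrite lt_min !divr_gt0// mulr_gt0.
have [m mpos mh] := small_gridstep A q0.
have h0 := gridstep_gt0 A0 mpos; set h := gridstep A m in mh h0.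
have [hr hd] : 2 * (N.+1%:R * h) < r /\ N.+1%:R * h < d / 8.
  split.
    have : h < r / (2 * N.+1%:R) by apply: lt_le_trans mh _; rewrite ge_min lexx.
    by rewrite ltr_pdivlMr ?mulr_gt0//; lra.
  have : h < d / (8 * N.+1%:R) by apply: lt_le_trans mh _; rewrite ge_min lexx orbT.
  by rewrite ltr_pdivlMr ?mulr_gt0//; lra.
have NR : N%:R * h < N.+1%:R * h by rewrite ltr_pM2r// ltr_nat.
have Nh0 : 0 <= N%:R * h by rewrite mulr_ge0// ltW.
pose cell (k : {ffun 'I_N -> 'I_m}) := [set q : 'rV[R]_N * 'rV[R]_N * R |
  [/\ cube (gridpt A k) h q.1.1, ncoord q.1.1 q.1.2 q.2 & q.2 < d]].
(* Each nonempty cell gets a representative where [w] is maximal up to [del]; the supremum over a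
   cell may not be attained. *)
have /choice[q qP] k : exists q, cell k !=set0 ->
    cell k q /\ forall q', cell k q' -> w q'.1.2 <= w q.1.2 + del.
  have [ne|ne] := pselect (cell k !=set0); last by exists (0, 0, 0).
  have [||a [q cq <-] qmax] := @exists_near_sup R [set w q.1.2 | q in cell k] (w z0) del _ _ del0.
  - by have [q cq] := ne; exists (w q.1.2); exists q.
  - by move=> _ [q' [_ [/= bz _] _] <-]; apply: zmax; rewrite inE; exact: bdry_dom_closure bz.
  by exists q => _; split => // q' cq'; apply: qmax; exists q'.
pose good k := `[< cell k !=set0 >].
have goodP k : good k -> cell k (q k) by move=> /asboolP /qP[].
pose yk k := (q k).1.1; pose zk k := (q k).1.2; pose sk k := (q k).2.
(* The extra [(N + 1) h] exceeds the diameter bound [N h], so the cube at [wk k] avoids the closure.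
   Its points are within [d/4 + d/8 + d/8] of [zk k], hence within [3d/4] of a patch point at
   distance below [d/4] from [zk k]. *)
pose wk k := zk k + (1 / 4 * sk k + N.+1%:R * h) *: eta (zk k).
pose a k := if good k then w (zk k) else 0.
have a0 k : 0 <= a k by rewrite /a; case: ifP.
have dp : 0 < d := d0.
have dsp : d < s0 := ds0.
have shift k : good k -> [/\ bdry Om (zk k), 0 < sk k, sk k < d &
    ncoord (wk k) (zk k) (1 / 4 * sk k + N.+1%:R * h)].
  move=> /goodP [_ [/= bz [/andP[sp _] _]] sd]; split => //; split => //=; split => //.
  by apply/andP; split; rewrite /sk; lra.
have up : outer u t x <= \sum_k (Jm * (a k + del)) * h ^+ N.
  apply: (@iint_le_step _ _ _ _ (@gridpt R N A m)) => [|k|y]; first exact: ltW.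
    by rewrite mulr_ge0 ?addr_ge0// ltW.
  have [->|[z [s [c sd yx ->]]]] := outer_densityP u t y Kx; [by left|right].
  have [|k ky] := @grid_cover R N A m y A0 mpos.
    move=> i; apply: le_lt_trans (coord_le_enorm _ i) _.
    by have := enorm_dist_ge y x; have := KM _ Kx; rewrite /A; lra.
  exists k => //.
  have ck : cell k (y, z, s) by [].
  have gk : good k by apply/asboolP; exists (y, z, s).
  rewrite ler_pM ?powR_ge0// /a gk.
  by have /asboolP/qP[_ /(_ _ ck)] := gk.
pose b k := Num.max 0 (a k - del).
have b0 k : 0 <= b k by rewrite le_max lexx.
have ab k : a k <= b k + del by rewrite -lerBlDr le_max lexx orbT.
pose pat c k := good k && (enorm (zk k - c) < d / 8).
have jm0 : 0 < j0 / m0%:R by rewrite divr_gt0.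
(* The step function on the shifted cubes of one patch lies below the density: at most [m0] cubes
   meet at a point, and the factor [1 / m0] absorbs this. *)
have low c : c \in net ->
    \sum_k (if pat c k then j0 / m0%:R * b k else 0) * h ^+ N <= outer u t (zc c).
  move=> cnet; have [bzc zcc] := zcP _ cnet.
  have Kzc := bdry_dom_closure bzc.
  have [A' [C' [A'0 bb]]] := outer_density_bounded cu u0 Kzc.
  rewrite -big_enum -(iint_step _ wk (ltW h0)); last first.
    by move=> k; case: ifP => // _; rewrite mulr_ge0// ltW.
  apply: (iint_le A'0 bb) => y.
  rewrite /step big_enum/=.
  (* The foot of any [y] in the shifted cube is within [r] of [zk k], so [w] drops by at most
     [del]. *)
  have hit k : pat c k -> cube (wk k) h y -> j0 * b k <= outer_density u t (zc c) y.
    move=> /andP[gk zkc] ky; have [bz sp sd cw'] := shift k gk.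
    have yw := cube_diam (ltW h0) ky (cube_corner (wk k) h0).
    have wz := normal_coord_dist rhoOm cw'.
    have nKy : ~ K y.
      move=> Ky; have := normal_coord_nearest Om_bounded Om0 rhoOm coords cw' Ky.
      rewrite enormC; lra.
    have yz : enorm (y - zk k) <= d / 2.
      have := ler_enorm_dist y (wk k) (zk k); rewrite wz; lra.
    have Kz := bdry_dom_closure bz.
    have yzs0 : enorm (y - zk k) < s0 by lra.
    have [z' [s' c']] := normal_coord_exists Om_bounded Om0 rhoOm nKy Kz yzs0.
    have s'd : s' <= d / 2.
      by apply: le_trans yz; exact: (normal_coord_nearest Om_bounded Om0 rhoOm coords c' Kz).
    have dd : 0 < d < s0 by rewrite d0.
    have sd2 : 1 / 4 * sk k + N.+1%:R * h <= d / 2 by lra.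
    have zz : enorm (z' - zk k) <= 2 * enorm (y - wk k).
      exact: (foot_lipschitz Om_bounded Om0 rhoOm coords dd c' cw' s'd sd2).
    have Kz' : K z' by case: c' => /= /bdry_dom_closure.
    have /(rP _ _ Kz' Kz) : `|z' - zk k| < r.
      by apply: le_lt_trans (mx_norm_le_enorm _) _; lra.
    rewrite ltr_norml => /andP[W1 W2].
    rewrite (outer_density_normal_coord _ _ _ c') ler_pM ?(ltW j00)//.
      apply: Jj0; rewrite enormC; have := ler_enorm_dist y (zk k) (zc c).
      have := ler_enorm_dist (zk k) c (zc c); rewrite (enormC c); lra.
    by rewrite ge_max -/(w z') w0 /a gk; lra.
  have [[k0 [pk0 ky0]]|no] := pselect (exists k, pat c k /\ cube (wk k) h y); last first.
    rewrite big1 ?outer_density_ge0// => k _; case: ifP => [pk|]; last by rewrite mul0r.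
    by case: (boolP (cube _ _ _)) => [ky|]; [case: no; exists k|rewrite mulr0].
  (* One hit cube [k0] is fixed; every other hit cube has its index within [L] of [k0] in each
     coordinate. *)
  set D := [set l : {ffun 'I_N -> 'I_m} | [forall i, (k0 i <= l i + L)%N && (l i <= k0 i + L)%N]].
  have inD l : pat c l -> cube (wk l) h y -> l \in D.
    move=> pl ly; rewrite inE.
    have [/andP[gk0 _] /andP[gl _]] := (pk0, pl).
    have [c1 n1 _] := goodP _ gk0; have [c2 n2 _] := goodP _ gl.
    have [bz1 s1 _ cw1] := shift _ gk0; have [bz2 s2 _ cw2] := shift _ gl.
    have th : 0 < (1 / 4 : R) <= 1 by rewrite divr_gt0//= ler_pdivrMr// mul1r ler1n.
    have E := contraction_to_foot_expands Om_bounded Om0 rhoOm coords n1 n2 th.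
    have D1 := cube_diam (ltW h0) ky0 (cube_corner (wk k0) h0).
    have D2 := cube_diam (ltW h0) ly (cube_corner (wk l) h0).
    have T1 := ler_enorm_dist (wk k0) y (wk l).
    rewrite (enormC (wk k0) y) in T1.
    have T2 : enorm (zk k0 + (1 / 4 * sk k0) *: eta (zk k0) - (zk l + (1 / 4 * sk l) *: eta (zk l)))
        <= enorm (wk k0 - wk l) + 2 * (N.+1%:R * h).
      have -> : zk k0 + (1 / 4 * sk k0) *: eta (zk k0) - (zk l + (1 / 4 * sk l) *: eta (zk l))
        = (wk k0 - wk l) + ((N.+1%:R * h) *: eta (zk l) - (N.+1%:R * h) *: eta (zk k0)).
        rewrite /wk !scalerDl !opprD.
        move: (zk k0) (zk l) (_ *: eta (zk k0)) (_ *: eta (zk l)) (_ *: eta (zk k0)) (_ *: eta (zk l)) => X1 X2 X3 X4 X5 X6.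
        by apply/rowP => i; rewrite !mxE; ring.
      apply: le_trans (ler_enormD _ _) _; rewrite lerD2l.
      apply: le_trans (ler_enormD _ _) _; rewrite enormN !(enormZ (N.+1%:R * h)).
      rewrite (ext_normal_unit rhoOm bz1) (ext_normal_unit rhoOm bz2) !mulr1.
      rewrite gtr0_norm; last by rewrite mulr_gt0.
      exact: addrr_le_mul2.
    have G1 := cube_diam (ltW h0) c1 (cube_corner (gridpt A k0) h0).
    have G2 := cube_diam (ltW h0) c2 (cube_corner (gridpt A l) h0).
    have T3 := ler_enorm_dist (gridpt A k0) (yk k0) (gridpt A l).
    have T4 := ler_enorm_dist (yk k0) (yk l) (gridpt A l).
    rewrite (enormC (gridpt A k0) (yk k0)) in T3.
    have far : enorm (gridpt A k0 - gridpt A l) < L.+1%:R * h.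
      rewrite -natr1 LE natrM mulrDl mul1r.
      have E' : 1 / 4 * enorm (yk k0 - yk l) <= enorm (zk k0 + (1 / 4 * sk k0) *: eta (zk k0) - (zk l + (1 / 4 * sk l) *: eta (zk l))) by exact: E.
      have G1' : enorm (yk k0 - gridpt A k0) <= N%:R * h by exact: G1.
      have G2' : enorm (yk l - gridpt A l) <= N%:R * h by exact: G2.
      rewrite -mulrA.
      exact: (overlap_arith h0 NR E' T2 T1 D1 D2 T3 T4 G1' G2').
    apply/forallP => i; apply/andP; split.
      apply: (grid_coord_near (A := A)) => //; rewrite -/h.
      by apply: le_lt_trans far; exact: coord_le_enorm.
    apply: (grid_coord_near (A := A)) => //; rewrite -/h.
    by apply: le_lt_trans far; rewrite enormC; exact: coord_le_enorm.
  apply: (@le_trans _ _ (\sum_(k in D) outer_density u t (zc c) y / m0%:R)).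
    rewrite [leRHS]big_mkcond/=; apply: ler_sum => k _.
    have od0 : 0 <= outer_density u t (zc c) y / m0%:R by rewrite divr_ge0 ?outer_density_ge0.
    case: (boolP (pat c k)) => [pk|_]; last by rewrite mul0r; case: ifP.
    case: (boolP (cube _ _ _)) => [ky|_]; last by rewrite mulr0; case: ifP.
    by rewrite mulr1 (inD _ pk ky) mulrAC ler_pM2r ?invr_gt0//; exact: hit.
  rewrite sumr_const -[leLHS]mulr_natr mulrAC ler_pdivrMr// ler_wpM2l ?outer_density_ge0//.
  by rewrite ler_nat; exact: grid_near_card.
(* Each nonempty cell is counted in at least one patch. *)
have cover : \sum_k j0 / m0%:R * b k * h ^+ N <= \sum_(c <- net) outer u t (zc c).
  apply: (@le_trans _ _ (\sum_(c <- net) \sum_k (if pat c k then j0 / m0%:R * b k else 0) * h ^+ N)).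
    rewrite exchange_big/=; apply: ler_sum => k _.
    have t0 c : 0 <= (if pat c k then j0 / m0%:R * b k else 0) * h ^+ N.
      by rewrite mulr_ge0 ?exprn_ge0 ?(ltW h0)//; case: ifP => // _; rewrite mulr_ge0// ltW.
    case: (boolP (good k)) => gk; last first.
      have bk : b k = 0 by rewrite /b /a (negPf gk) sub0r max_l// oppr_le0 ltW.
      have -> : j0 / m0%:R * b k * h ^+ N = 0 by rewrite bk mulr0 mul0r.
      by apply: sumr_ge0 => c _; exact: t0.
    have [bz _ _ _] := shift _ gk; have [c cn zc'] := netP _ bz.
    rewrite (big_rem c cn)/= {1}/pat gk zc' /= lerDl.
    by apply: sumr_ge0 => c' _; exact: t0.
  rewrite big_seq [leRHS]big_seq; apply: ler_sum => c cn; exact: low.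
apply: (le_trans up).
(* The error [2 Jm] per unit volume comes from two losses of [del]: near-maximality, and passing
   from [a] to [b]. *)
apply: (@le_trans _ _ (\sum_(k : {ffun 'I_N -> 'I_m})
  (Jm * (m0%:R / j0) * (j0 / m0%:R * b k * h ^+ N) + del * (2 * Jm) * h ^+ N))).
  apply: ler_sum => k _.
  have -> : Jm * (m0%:R / j0) * (j0 / m0%:R * b k * h ^+ N) = Jm * b k * h ^+ N.
    by field; rewrite !gt_eqF.
  rewrite -mulrDl ler_wpM2r ?exprn_ge0 ?(ltW h0)//.
  have -> : Jm * b k + del * (2 * Jm) = Jm * (b k + del + del) by ring.
  by rewrite ler_wpM2l ?(ltW Jm0)// lerD2r ab.
rewrite big_split/= -!mulr_sumr grid_card_volume// -[del * _ * _]mulrA lerD2r.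
by rewrite ler_wpM2l// mulr_ge0 ?divr_ge0 ?(ltW Jm0) ?(ltW j00)//.
Qed.

End OuterIntegral.


(** * Differential inequalities and first contact in time *)

Section TimeDerivative.
Context {R : realType}.

(** Uses left difference quotients alone: at a first contact only earlier times can be compared. *)
Lemma is_derive_ge0_left (f : R -> R) (D a t : R) : is_derive t 1 f D -> a < t ->
  (forall s, a <= s < t -> f s <= f t) -> 0 <= D.
Proof.
move=> [fd fD] at0 fs; rewrite leNgt; apply/negP => D0.
have D0' : 0 < - D by rewrite oppr_gt0.
move: fd; rewrite /derivable /= => /cvg_ex[l lE].
have {}lE : h^-1 *: (f (h *: 1 + t) - f t) @[h --> 0^'] --> D.
  by rewrite -fD /derive (cvg_lim _ lE).
move/cvgrPdist_lt: lE => /(_ _ D0').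
rewrite near_withinE => /nbhs_normP[r /= r0 H].
pose h := Num.min (r / 2) (t - a).
have h0 : 0 < h by rewrite lt_min subr_gt0 at0 divr_gt0.
have hr : h < r by rewrite gt_min; apply/orP; left; rewrite ltr_pdivrMr// ltr_pMr// ltr1n.
have ha : h <= t - a by rewrite ge_min lexx orbT.
have hr' : `|0 - - h| < r by rewrite sub0r opprK gtr0_norm.
have hn : - h != 0 by rewrite oppr_eq0 gt_eqF.
have := H (- h) hr' hn.
have -> : (- h)^-1 *: (f (- h *: 1 + t) - f t) = (f t - f (t - h)) / h.
  have -> : - h *: (1 : R) = - h by exact: mulr1.
  rewrite (addrC (- h)) invrN -[LHS]/(- h^-1 * (f (t - h) - f t)).
  by rewrite mulNr -mulrN opprB mulrC.
have : 0 <= (f t - f (t - h)) / h.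
  rewrite divr_ge0 ?(ltW h0)// subr_ge0 fs//; apply/andP; split; lra.
by rewrite ltr_norml => ? /andP[? ?]; lra.
Qed.

Lemma derive_le_increment (f df : R -> R) (a b c : R) : a <= b ->
  (forall t, a < t < b -> is_derive t 1 f (df t)) -> {within `[a, b], continuous f} ->
  (forall t, a < t < b -> df t <= c) -> f b - f a <= c * (b - a).
Proof.
rewrite le_eqVlt => /predU1P[->|ab] fd cf fc; first by rewrite !subrr mulr0.
have fd' t : t \in `]a, b[ -> is_derive t 1 f (df t) by rewrite in_itv/=; exact: fd.
have [t] := MVT ab fd' cf.
by rewrite in_itv/= => tab ->; rewrite ler_wpM2r ?subr_ge0 ?(ltW ab)// fc.
Qed.

(** The integrating factor [expR (t - a)] is at least 1, so with [c >= 0] the source contributes at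
    least [c] per unit time. The sign in [g] turns the lower bound on [df] into an upper bound for
    the mean value theorem. *)
Lemma damped_growth (f df : R -> R) (a b c : R) : a <= b -> 0 <= c ->
  (forall t, a < t < b -> is_derive t 1 f (df t)) -> {within `[a, b], continuous f} ->
  (forall t, a < t < b -> - f t + c <= df t) ->
  expR (- (b - a)) * (f a + (b - a) * c) <= f b.
Proof.
move=> ab c0 fd cf fc.
pose g t := - (expR (t - a) * f t).
have gd t : a < t < b -> is_derive t 1 g (- (expR (t - a) * (df t) + f t * expR (t - a))).
  move=> tab; have fdt := fd _ tab.
  have sd : is_derive t 1 (fun s : R => s - a) 1.
    by have := is_deriveB (is_derive_id t (1 : R)) (is_derive_cst a t (1 : R)); rewrite subr0.
  have ed : is_derive t 1 (fun s => expR (s - a)) (expR (t - a)).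
    have := @is_derive1_comp R expR (fun s : R => s - a) t (expR (t - a)) 1 (is_derive_expR _) sd.
    by rewrite mulr1.
  exact: is_deriveN (is_deriveM ed fdt).
have cg : {within `[a, b], continuous g}.
  move=> t; apply: cvgN; apply: cvgM; last exact: cf.
  apply: continuous_subspaceT => s.
  apply: (@continuous_comp _ _ _ (fun s : R => s - a) expR); last exact: continuous_expR.
  by apply: cvgB; [exact: cvg_id|exact: cvg_cst].
have := @derive_le_increment g _ a b (- c) ab gd cg.
have H t : a < t < b -> - (expR (t - a) * df t + f t * expR (t - a)) <= - c.
  move=> tab; rewrite lerN2 mulrC -mulrDl.
  have e1 : 1 <= expR (t - a) by rewrite -expR0 ler_expR subr_ge0 ltW//; case/andP: tab.
  have := fc _ tab => k; have q : c <= df t + f t by lra.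
  apply: le_trans q _; rewrite ler_peMr//; lra.
move=> /(_ H); rewrite /g subrr expR0 mul1r => K.
rewrite expRN mulrC ler_pdivrMr ?expR_gt0// mulrC; lra.
Qed.

End TimeDerivative.

Section JointContinuity.
Context {R : realType} {N : nat}.
Implicit Types (K : set 'rV[R]_N) (g : 'rV[R]_N -> R -> R) (I : set R).

Definition joint_continuous K I g := forall x t, K x -> I t -> forall e : R, 0 < e ->
  exists2 r : R, 0 < r & forall y s, K y -> I s -> enorm (y - x) < r -> `|s - t| < r ->
    `|g x t - g y s| < e.

Lemma within_joint_continuous K I g :
  {within K `*` I, continuous (fun xt : 'rV[R]_N * R => g xt.1 xt.2)} -> joint_continuous K I g.
Proof.
move=> /subspace_continuousP cg x t Kx It e e0.
have /(@cvgrPdist_lt _ _ _ (within (K `*` I) (nbhs (x, t))))/(_ e e0) := cg (x, t) (conj Kx It).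
rewrite near_withinE => -[[P Q] /= [/nbhs_eballP[r r0 rP] /nbhs_normP[r' /= r'0 r'Q]] PQ].
exists (Num.min r r') => [|y s Ky Is]; first by rewrite lt_min r0.
rewrite !lt_min => /andP[yr _] /andP[_ sr].
apply: (PQ (y, s)) => //; split => /=; first exact: rP.
by apply: r'Q => /=; rewrite distrC.
Qed.

Lemma joint_continuousW K I I' g : I `<=` I' -> joint_continuous K I' g -> joint_continuous K I g.
Proof.
move=> II' cg x t Kx It e e0; have [r r0 rP] := cg x t Kx (II' _ It) e e0.
by exists r => // y s Ky Is; apply: rP => //; exact: II'.
Qed.

Lemma joint_continuous_time K I g x : joint_continuous K I g -> K x ->
  {within I, continuous (g x)}.
Proof.
move=> cg Kx; apply/subspace_continuousP => t It.
apply/cvgrPdist_lt => e e0; have [r r0 rP] := cg x t Kx It e e0.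
rewrite near_withinE; apply/nbhs_normP; exists r => // s /= st Is.
by apply: rP => //; rewrite ?subrr ?enorm0// distrC.
Qed.

Lemma joint_continuous_space K I g t : joint_continuous K I g -> I t ->
  {within K, continuous (g ^~ t)}.
Proof.
move=> cg It; apply/within_continuous_eballP => x Kx e e0.
have [r r0 rP] := cg x t Kx It e e0.
by exists r => // y Ky yx; apply: rP => //; rewrite subrr normr0.
Qed.

Lemma joint_continuousN K I g : joint_continuous K I g -> joint_continuous K I (fun x t => - g x t).
Proof.
move=> cg x t Kx It e e0; have [r r0 rP] := cg x t Kx It e e0.
exists r => // y s Ky Is yx st; have := rP y s Ky Is yx st.
by rewrite !ltr_norml => /andP[? ?]; apply/andP; split; lra.
Qed.

Lemma joint_continuousD K I g (w : R -> R) : joint_continuous K I g ->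
  {within I, continuous w} -> joint_continuous K I (fun x t => g x t + w t).
Proof.
move=> cg /subspace_continuousP cw x t Kx It e e0; have e2 : 0 < e / 2 by rewrite divr_gt0.
have [r r0 rP] := cg x t Kx It _ e2.
have /cvgrPdist_lt/(_ _ e2) := cw t It.
rewrite near_withinE => /nbhs_normP[r' /= r'0 r'P].
exists (Num.min r r') => [|y s Ky Is]; first by rewrite lt_min r0.
rewrite !lt_min => /andP[yr _] /andP[sr sr'].
have st' : `|t - s| < r' by rewrite distrC.
have := rP y s Ky Is yr sr; have := r'P s st' Is; rewrite /from_subspace.
by rewrite !ltr_norml => /andP[? ?] /andP[? ?]; apply/andP; split; lra.
Qed.

Lemma joint_continuous_closed K (a b : R) g : compact K -> closed K ->
  joint_continuous K `[a, b] g ->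
  compact [set xt : 'rV[R]_N * R | [/\ K xt.1, `[a, b]%classic xt.2 & 0 <= g xt.1 xt.2]].
Proof.
move=> cK clK cg.
apply: (@subclosed_compact _ _ (K `*` `[a, b])).
- move=> [x t] cl.
  have near_cl (r : R) : 0 < r -> exists y s, [/\ K y, `[a, b]%classic s, 0 <= g y s,
      enorm (y - x) < r & `|s - t| < r].
    move=> r0; have [|[y s] [[/= Ky Is gys] [/= yx st]]] :=
        cl ([set y | enorm (y - x) < r] `*` [set s | `|s - t| < r]).
      exists ([set y | enorm (y - x) < r], [set s | `|s - t| < r]); last by [].
      split; first by apply/nbhs_eballP; exists r.
      by apply/nbhs_normP; exists r => // s /=; rewrite distrC.
    by exists y, s.
  have Kx : K x.
    by apply: clK; apply/closure_eballP => r /near_cl[y [s [? _ _ ? _]]]; exists y.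
  have It : `[a, b]%classic t.
    rewrite /= in_itv/=; apply/andP; split; apply/ler_addgt0Pr => r /near_cl[y [s [_ + _ _]]];
      by rewrite /= in_itv/= ltr_norml => /andP[? ?] /andP[? ?]; lra.
  split => //=; rewrite leNgt; apply/negP => gn.
  have gn' : 0 < - g x t by rewrite oppr_gt0.
  have [r /near_cl[y [s [Ky Is gys yx st]]] H] := cg x t Kx It _ gn'.
  by have := H y s Ky Is yx st; rewrite ltr_norml => /andP[? ?]; lra.
- by apply: compact_setX => //; exact: segment_compact.
- by move=> [x t] [].
Qed.

(** The time coordinate is minimised over the compact set where [g] is nonnegative, so the contact
    is first for all space points at once. *)
Lemma first_touch K (a b : R) g : compact K -> closed K -> joint_continuous K `[a, b] g ->
  (forall x, K x -> g x a < 0) -> (exists x t, [/\ K x, a <= t <= b & 0 <= g x t]) ->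
  exists x t, [/\ K x, a < t <= b, g x t = 0,
    (forall y s, K y -> a <= s < t -> g y s < 0) & (forall y, K y -> g y t <= 0)].
Proof.
move=> cK clK cg ga [x1 [t1 [Kx1 It1 g1]]].
have cS := joint_continuous_closed cK clK cg.
have S0 : [set xt : 'rV[R]_N * R | [/\ K xt.1, `[a, b]%classic xt.2 & 0 <= g xt.1 xt.2]] !=set0.
  by exists (x1, t1).
have csnd : continuous (fun xt : 'rV[R]_N * R => xt.2) by move=> xt; exact: cvg_snd.
have [[x t] xtS tmin] := compact_EVT_min S0 cS (continuous_subspaceT csnd).
have {xtS} [/= Kx It gxt] := set_mem xtS.
have before y s : K y -> a <= s < t -> g y s < 0.
  move=> Ky /andP[as_ st]; rewrite ltNge; apply/negP => gys.
  have /= := tmin (y, s); rewrite leNgt st => H.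
  suff : false by []; apply: H; rewrite inE; split => //=.
  rewrite in_itv/= as_ /=; move: It; rewrite in_itv/= => /andP[_].
  by apply: le_trans; exact: ltW.
move: (It); rewrite in_itv/= => /andP[at_ tb].
have at' : a < t.
  by rewrite lt_neqAle at_ andbT; apply: contraTneq gxt => <-; rewrite -ltNge ga.
(* A positive value at time [t] would persist slightly earlier, against minimality of [t]. *)
have at_t y : K y -> g y t <= 0.
  move=> Ky; rewrite leNgt; apply/negP => gyt.
  have [r r0 H] := cg y t Ky It _ gyt.
  pose s := Num.max a (t - r / 2).
  have st : s < t by rewrite gt_max at' ltrBlDr ltrDl divr_gt0.
  have as_ : a <= s by rewrite le_max lexx.
  have sr : t - r / 2 <= s by rewrite le_max lexx orbT.
  have Is : `[a, b]%classic s by rewrite /= in_itv/= as_ (le_trans (ltW st)).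
  have := H y s Ky Is; rewrite subrr enorm0 => /(_ r0).
  have -> : `|s - t| < r by rewrite ltr_norml; apply/andP; split; lra.
  have := before y s Ky; rewrite as_ st => /(_ isT) gs /(_ isT).
  by rewrite ltr_norml => /andP[? ?]; lra.
exists x, t; split => //; first by rewrite at'.
by apply/eqP; rewrite eq_le at_t.
Qed.

End JointContinuity.


Lemma seq_common_pos (R : realType) (T : eqType) (s : seq T) (P : T -> R -> Prop) :
  (forall c, c \in s -> exists2 k : R, 0 < k & P c k) ->
  (forall c k k', 0 < k' -> k' <= k -> P c k -> P c k') ->
  exists2 k : R, 0 < k & forall c, c \in s -> P c k.
Proof.
move=> + anti; elim: s => [|c s IH] H; first by exists 1.
have [|k1 k10 P1] := IH; first by move=> c' c's; apply: H; rewrite inE c's orbT.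
have [k2 k20 P2] := H c (mem_head _ _).
have m0 : 0 < Num.min k1 k2 by rewrite lt_min k10.
exists (Num.min k1 k2) => // c'; rewrite inE => /predU1P[->|c's].
  by apply: (anti _ k2) => //; rewrite ge_min lexx orbT.
by apply: (anti _ k1); rewrite ?ge_min ?lexx//; exact: P1.
Qed.

Lemma bdry_compact (R : realType) (N : nat) (Om : set 'rV[R]_N) :
  compact (closure Om) -> compact (bdry Om).
Proof.
move=> cK; apply: (subclosed_compact _ cK); last by move=> z [].
rewrite /bdry setDE; apply: closedI; first exact: closed_closure.
by apply: open_closedC; exact: open_interior.
Qed.

Lemma powRN_le (R : realType) (a b e : R) : 0 < a -> a <= b -> 0 <= e -> b `^ (- e) <= a `^ (- e).
Proof.
move=> a0 ab e0; have b0 := lt_le_trans a0 ab.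
rewrite !powRN lef_pV2 ?posrE ?powR_gt0//.
by apply: ge0_ler_powR; rewrite ?nnegrE ?(ltW a0) ?(ltW b0).
Qed.

Lemma is_derive_powR (R : realType) (a e : R) : 0 < a ->
  is_derive a 1 (fun b : R => b `^ e) (e * a `^ (e - 1)).
Proof.
move=> a0; have aI : a \in `]0, +oo[ by rewrite in_itv/= a0.
have D : derivable (fun b : R => b `^ e) a 1 by apply: derivable_powR.
by apply: (DeriveDef D); rewrite -derive1E powR_derive1.
Qed.

(** * The solution: positivity, bounds on its time derivative, supremum norm *)

Section Solution.
Context {R : realType} {N : nat} (Om : set 'rV[R]_N) (rho J : 'rV[R]_N -> R).
Context (d s0 p T : R) (u0 : 'rV[R]_N -> R) (u : 'rV[R]_N -> R -> R).
Hypotheses (Om_bounded : exists M : R, forall x, Om x -> enorm x <= M) (Om0 : Om !=set0).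
Hypothesis rhoOm : defining_function Om rho.
Hypotheses (cJ : continuous J) (J0 : forall x, 0 <= J x) (Jsym : forall x, J (- x) = J x).
Hypotheses (J1 : iint J = 1) (d0 : 0 < d).
Hypotheses (Jpos : forall x, enorm x < d -> 0 < J x) (Jd : forall x, d <= enorm x -> J x = 0).
Hypotheses (ds0 : d < s0) (coords : normal_coordinates Om (ext_normal rho) s0).
Hypothesis p1 : 1 < p.
Hypothesis u0_ge0 : forall x, closure Om x -> 0 <= u0 x.
Hypothesis sol : solution_P Om J (ext_normal rho) s0 p u0 T u.
Notation K := (closure Om).
Notation eta := (ext_normal rho).
Notation ncoord y z s := (normal_coord Om eta s0 y (z, s)).
Notation rhs x t := (rhsP Om J eta s0 p u x t).
Notation out := (outer Om rho s0 J p u).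

Definition inner_density (t : R) (x y : 'rV[R]_N) : R :=
  \1_Om y * (J (x - y) * (u y t - u x t)).

Lemma rhsPE x t : rhs x t = iint (inner_density t x) + out t x.
Proof. by []. Qed.

Let cK : compact K := compact_closure_dom Om_bounded.
Let clK : closed K := @closed_closure _ Om.
Let K0 : K !=set0 := closure_dom_nonempty Om0.

Lemma sol_joint_continuous : joint_continuous K [set t | 0 <= t < T] u.
Proof. by apply: within_joint_continuous; case: sol. Qed.

Lemma sol_joint_continuous_itv a b : 0 <= a -> b < T -> joint_continuous K `[a, b] u.
Proof.
move=> a0 bT; apply: joint_continuousW sol_joint_continuous => t /=.
rewrite in_itv/= => /andP[at_ tb]; apply/andP; split; first exact: le_trans at_.
exact: le_lt_trans bT.
Qed.

Lemma sol_is_derive x t : K x -> 0 < t < T -> is_derive t 1 (u x) (rhs x t).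
Proof. by case: sol => _ [_]; apply. Qed.

Lemma sol_continuous_itv x a b : K x -> 0 <= a -> b < T -> {within `[a, b], continuous (u x)}.
Proof. by move=> Kx a0 bT; exact: joint_continuous_time (sol_joint_continuous_itv a0 bT) Kx. Qed.

Lemma inner_ge0 t x : (forall y, K y -> u x t <= u y t) -> 0 <= iint (inner_density t x).
Proof.
move=> H; apply: iint_ge0 => y; rewrite /inner_density indicE.
have [/set_mem/subset_closure Ky|_] := boolP (y \in Om); last by rewrite mul0r.
by rewrite mul1r mulr_ge0// subr_ge0 H.
Qed.

Lemma inner_le0 t x : (forall y, K y -> u y t <= u x t) -> iint (inner_density t x) <= 0.
Proof.
move=> H; rewrite -oppr_ge0 -iintN; apply: iint_ge0 => y; rewrite /inner_density indicE.
have [/set_mem/subset_closure Ky|_] := boolP (y \in Om); last by rewrite mul0r oppr0.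
by rewrite mul1r -mulrN mulr_ge0// opprB subr_ge0 H.
Qed.

(** Minimum principle for [u + e (1 + t)]: at a first zero the diffusion term is nonnegative, and so
    is the exterior term whatever the sign of [u], as [powR] takes no negative value. The [e t]
    makes the contradiction strict. *)
Lemma sol_ge0 x t : K x -> 0 <= t < T -> 0 <= u x t.
Proof.
move=> Kx /andP[t0 tT].
have T0 : 0 < T by exact: le_lt_trans tT.
suff H e : 0 < e -> 0 <= u x t + e * (1 + t).
  apply/ler_addgt0Pr => e e0; have t1 : 0 < 1 + t by rewrite ltr_pwDl.
  by have := H (e / (1 + t)); rewrite divfK ?gt_eqF// divr_gt0//; apply.
move=> e0; rewrite leNgt; apply/negP => neg.
pose g (y : 'rV[R]_N) (s : R) := - u y s + - (e * (1 + s)).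
have cg : joint_continuous K `[0, t] g.
  apply: joint_continuousD; first by apply: joint_continuousN; exact: sol_joint_continuous_itv.
  apply: continuous_subspaceT => s; apply: cvgN; apply: cvgM; first exact: cvg_cst.
  by apply: cvgD; [exact: cvg_cst|exact: cvg_id].
have [||y [s [Ky /andP[s00 st] gys before now]]] := first_touch cK clK cg.
- move=> y Ky; rewrite /g addr0 mulr1; case: sol => _ [-> // _].
  by have := u0_ge0 Ky; lra.
- by exists x, t; split => //; rewrite ?t0 ?lexx// /g; lra.
have sT : 0 < s < T by rewrite s00 (le_lt_trans st).
have gd : is_derive s 1 (g y) (- rhs y s + - (e * 1)).
  have ud := sol_is_derive Ky sT.
  have ld : is_derive s 1 (fun r : R => - (e * (1 + r))) (- (e * 1)).
    have a1 : is_derive s 1 (fun r : R => 1 + r) 1.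
      by have := is_deriveD (is_derive_cst (1 : R) s (1 : R)) (is_derive_id s (1 : R)); rewrite add0r.
    exact: is_deriveN (is_deriveZ e a1).
  exact: is_deriveD (is_deriveN ud) ld.
have D0 : 0 <= - rhs y s + - (e * 1).
  apply: (is_derive_ge0_left gd s00) => r rs.
  by rewrite gys; apply: ltW; exact: before.
have mins z : K z -> u y s <= u z s.
  by move=> /now; move: gys; rewrite /g; lra.
have := inner_ge0 mins; have := outer_ge0 Om rho s0 p J0 u s y.
by rewrite rhsPE in D0; lra.
Qed.

Lemma kernel_const_bounded (c : R) x : 0 <= c ->
  exists A C : R, 0 <= A /\ box_bounded A C (fun y => c * J (x - y)).
Proof. by move=> c0; exact: (kernel_box_bounded cJ J0 d0 Jd). Qed.

Lemma kernel_mass_le (c : R) x : 0 <= c -> iint (fun y => c * J (x - y)) <= c.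
Proof. by move=> c0; exact: (iint_kernel_le cJ J0 Jsym J1 d0 Jd). Qed.

Lemma rhs_le x t (M : R) : K x -> 0 < t < T -> (forall y, K y -> u y t <= M) ->
  rhs x t <= M + out t x.
Proof.
move=> Kx tT uM; have tT' : 0 <= t < T by case/andP: tT => /ltW -> ->.
have M0 : 0 <= M by apply: le_trans (uM _ Kx); exact: sol_ge0.
rewrite rhsPE lerD2r; apply: le_trans (kernel_mass_le x M0).
have [A [C [A0 b]]] := kernel_const_bounded x M0.
apply: (iint_le A0 b) => y; rewrite /inner_density indicE.
have [/set_mem/subset_closure Ky|_] := boolP (y \in Om); last by rewrite mul0r mulr_ge0.
rewrite mul1r mulrC ler_wpM2r//; have := uM _ Ky; have := sol_ge0 Kx tT'; lra.
Qed.

(** Positivity of [u] discards the gain, and the loss is at most [u x t] times the kernel mass. *)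
Lemma rhs_ge x t : K x -> 0 < t < T -> - u x t + out t x <= rhs x t.
Proof.
move=> Kx tT; have tT' : 0 <= t < T by case/andP: tT => /ltW -> ->.
rewrite rhsPE lerD2r -[leRHS]opprK lerN2 -iintN.
have M0 := sol_ge0 Kx tT'.
apply: le_trans (kernel_mass_le x M0).
have [A [C [A0 b]]] := kernel_const_bounded x M0.
apply: (iint_le A0 b) => y; rewrite /inner_density indicE.
have [/set_mem/subset_closure Ky|_] := boolP (y \in Om); last by rewrite mul0r oppr0 mulr_ge0.
rewrite mul1r -mulrN mulrC ler_wpM2r//; have := sol_ge0 Ky tT'; lra.
Qed.

Lemma rhs_le_powR x t : K x -> 0 < t < T -> (forall y, K y -> u y t <= u x t) ->
  rhs x t <= u x t `^ p.
Proof.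
move=> Kx tT um; have tT' : 0 <= t < T by case/andP: tT => /ltW -> ->.
rewrite rhsPE -[leRHS]add0r; apply: lerD; first exact: inner_le0.
have P0 := powR_ge0 (u x t) p.
apply: le_trans (kernel_mass_le x P0).
have [A [C [A0 b]]] := kernel_const_bounded x P0.
apply: (iint_le A0 b) => y.
have [->|[z [s [[/= bz _] _ _ ->]]]] := outer_densityP Om_bounded Om0 rhoOm coords ds0 p1 Jd u t y Kx.
  by rewrite mulr_ge0.
have Kz := bdry_dom_closure bz.
rewrite mulrC ler_wpM2r//; apply: ge0_ler_powR.
- by apply: ltW; exact: lt_trans p1.
- by rewrite nnegrE sol_ge0.
- by rewrite nnegrE sol_ge0.
- exact: um.
Qed.

Lemma sol_bounded_itv b : b < T -> exists2 M : R, 0 <= M &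
  forall x t, K x -> 0 <= t <= b -> u x t <= M.
Proof.
move=> bT; have [b0|b0] := ltP b 0.
  by exists 0 => // x t _ /andP[t0 tb]; have := le_lt_trans (le_trans t0 tb) b0; rewrite ltxx.
have [x0 Kx0] := K0.
have cI : compact (K `*` `[0, b]%classic) by apply: compact_setX => //; exact: segment_compact.
have [] := @compact_EVT_max _ R (fun xt : 'rV[R]_N * R => u xt.1 xt.2) _ _ cI.
- by exists (x0, 0); split => //=; rewrite in_itv/= lexx.
- case: sol => + _; apply: continuous_subspaceW => -[x t] [/= Kx]; split => //=.
  by move: b1; rewrite /= in_itv/= => /andP[-> tb]; exact: le_lt_trans bT.
move=> [y s] /set_mem[/= Ky Is] H.
move: (Is); rewrite in_itv/= => /andP[s0' sb].
exists (u y s); first by apply: sol_ge0 => //; rewrite s0' (le_lt_trans sb).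
by move=> x t Kx tb; apply: (H (x, t)); rewrite inE; split => //=; rewrite in_itv.
Qed.

Lemma exists_record t : 0 <= t < T -> exists x tau, [/\ K x, 0 <= tau <= t &
  forall y s, K y -> 0 <= s <= t -> u y s <= u x tau].
Proof.
move=> /andP[t0 tT]; have [x0 Kx0] := K0.
have cI : compact (K `*` `[0, t]%classic) by apply: compact_setX => //; exact: segment_compact.
have [] := @compact_EVT_max _ R (fun xt : 'rV[R]_N * R => u xt.1 xt.2) _ _ cI.
- by exists (x0, 0); split => //=; rewrite in_itv/= lexx.
- case: sol => + _; apply: continuous_subspaceW => -[x s] [/= Kx].
  by rewrite in_itv/= => /andP[s0' st]; split => //=; rewrite s0' (le_lt_trans st).
move=> [y s] /set_mem[/= Ky]; rewrite in_itv/= => Is H.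
exists y, s; split => // x r Kx rt; apply: (H (x, r)).
by rewrite inE; split => //=; rewrite in_itv.
Qed.

(** The supremum is over [Om]; continuity and density reach boundary points, where maxima may
    sit. *)
Lemma Linf_ge x t : K x -> 0 <= t < T -> u x t <= Linf Om u t.
Proof.
move=> Kx tT; have [M M0 uM] : exists2 M : R, 0 <= M & forall x s, K x -> 0 <= s <= t -> u x s <= M.
  by apply: sol_bounded_itv; case/andP: tT.
have hs : has_sup [set `|u y t| | y in Om].
  split; first by have [y Oy] := Om0; exists `|u y t|; exists y.
  exists M => _ [y /subset_closure Ky <-]; rewrite ger0_norm ?sol_ge0//.
  by apply: uM => //; case/andP: tT => -> _; rewrite lexx.
apply/ler_addgt0Pr => e e0.
have cu := joint_continuous_space sol_joint_continuous tT.
have /within_continuous_eballP/(_ x Kx e e0)[r r0 H] := cu.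
have /closure_eballP/(_ r r0)[y Oy yx] := Kx.
have := H y (subset_closure Oy) yx; rewrite ltr_norml => /andP[_ uxy].
have : `|u y t| <= Linf Om u t by apply: sup_upper_bound => //; exists y.
by have := ler_norm (u y t); lra.
Qed.

Lemma Linf_le t (M : R) : 0 <= t < T -> (forall x, K x -> u x t <= M) -> Linf Om u t <= M.
Proof.
move=> tT uM; apply: ge_sup.
  by have [y Oy] := Om0; exists `|u y t|; exists y.
by move=> _ [y /subset_closure Ky <-]; rewrite ger0_norm ?sol_ge0// uM.
Qed.

(** * Records of the maximum and the growth they force *)

(** The maximum is taken over the whole past, so [u x tau] bounds [u] at all earlier times too. *)
Definition record_point x tau := [/\ K x, 0 <= tau < T &
  forall y s, K y -> 0 <= s <= tau -> u y s <= u x tau].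

(** Provides a fixed volume outside the domain that sees only values of [u] on the patch of [c],
    where the kernel centred at [c] has a positive lower bound. *)
Lemma bdry_exterior_cube c : bdry Om c -> exists a h, 0 < h /\
  forall y, cube a h y -> exists z s, [/\ ncoord y z s, enorm (z - c) < d / 8 &
    enorm (y - c) <= 3 / 4 * d].
Proof.
(* With the cube within [d/32] of a point at distance [d/32] from [c], its points are within [d/16]
   of [c] and their feet within [d/8]. *)
move=> bc; have d32 : 0 < d / 32 by rewrite divr_gt0.
have nc : ncoord (c + (d / 32) *: eta c) c (d / 32).
  by split => //=; split => //; rewrite d32/=; apply: lt_trans ds0; rewrite ltr_pdivrMr// ltr_pMr// ltr1n.
set y0 := c + (d / 32) *: eta c in nc.
have nK : ~ K y0.
  by move=> Ky; apply: (closure_no_normal_coord Om_bounded Om0 rhoOm coords Ky nc).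
have [r r0 rP] : exists2 r : R, 0 < r & forall y, enorm (y - y0) < r -> ~ K y.
  by apply/nbhs_eballP; have := closed_openC clK; rewrite openE => /(_ y0 nK).
have m0 : 0 < Num.min r (d / 32) by rewrite lt_min r0.
have Nn0 : 0 < N.+1%:R :> R by [].
pose h := Num.min r (d / 32) / N.+1%:R; have h0 : 0 < h by rewrite divr_gt0.
have Nh : N%:R * h < Num.min r (d / 32).
  have : N.+1%:R * h = Num.min r (d / 32) by rewrite /h mulrC divfK// gt_eqF.
  by move=> <-; rewrite ltr_pM2r// ltr_nat.
exists y0, h; split => // y yy0.
have yD := cube_diam (ltW h0) yy0 (cube_corner y0 h0).
have yr : enorm (y - y0) < r by apply: le_lt_trans yD (lt_le_trans Nh _); rewrite ge_min lexx.
have yd : enorm (y - y0) < d / 32 by apply: le_lt_trans yD (lt_le_trans Nh _); rewrite ge_min lexx orbT.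
have yc : enorm (y - c) < d / 16.
  have := ler_enorm_dist y y0 c; rewrite (normal_coord_dist rhoOm nc); lra.
have Kc := bdry_dom_closure bc.
have dp : 0 < d := d0; have dsp : d < s0 := ds0.
have ycs : enorm (y - c) < s0 by lra.
have [z [s ny]] := normal_coord_exists Om_bounded Om0 rhoOm (rP _ yr) Kc ycs.
have ns := normal_coord_nearest Om_bounded Om0 rhoOm coords ny Kc.
exists z, s; split => //; last by lra.
by have := ler_enorm_dist z y c; rewrite (enormC z y) (normal_coord_dist rhoOm ny); lra.
Qed.

Lemma outer_control : exists net C1, [/\ (forall c, c \in net -> bdry Om c),
  (forall z, bdry Om z -> exists2 c, c \in net & enorm (z - c) < d / 8), 0 <= C1 &
  forall (zc : 'rV[R]_N -> 'rV[R]_N) x t, 0 <= t < T ->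
    (forall c, c \in net -> bdry Om (zc c) /\ enorm (zc c - c) < d / 8) -> K x ->
    out t x <= C1 * \sum_(c <- net) out t (zc c)].
Proof.
have d8 : 0 < d / 8 by rewrite divr_gt0.
have [net [netb netP]] := finite_net (bdry_compact cK) d8.
have [Jm Jm0 JJm] := kernel_bounded cJ J0 d0 Jd.
have r0 : 0 <= 3 / 4 * d by rewrite mulr_ge0// ltW.
have Jr y : enorm y <= 3 / 4 * d -> 0 < J y.
  by move=> yd; apply: Jpos; apply: le_lt_trans yd _; have : 0 < d := d0; lra.
have [j0 j00 Jj0] := kernel_lower cJ r0 Jr.
exists net, (Jm * (((2 * (18 * N.+1)).+1 ^ N)%N%:R / j0)); split => //.
  by rewrite mulr_ge0 ?divr_ge0// ltW.
move=> zc x t tT zcP Kx.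
apply: (outer_le_patches Om_bounded Om0 rhoOm coords cJ J0 d0 ds0 p1 Jd) => //.
- exact: joint_continuous_space sol_joint_continuous tT.
- by move=> z Kz; exact: sol_ge0.
Qed.

Lemma is_derive_sum_seq (I : eqType) (r : seq I) (f : I -> R -> R) (df : I -> R) (t : R) :
  (forall c, c \in r -> is_derive t 1 (f c) (df c)) ->
  is_derive t 1 (fun s => \sum_(c <- r) f c s) (\sum_(c <- r) df c).
Proof.
elim: r => [|c r IH] H.
  under eq_fun do rewrite big_nil.
  by rewrite big_nil; exact: is_derive_cst.
under eq_fun do rewrite big_cons.
rewrite big_cons; apply: is_deriveD; first exact: H (mem_head _ _).
by apply: IH => c' c'r; apply: H; rewrite inE c'r orbT.
Qed.

(* If every patch contained a point where [u] is small compared with the record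
   value [u x tau], then [u x - C1 * sum_c u (z_c)] would have grown by more than
   [(tau - t0) (1 + C1 |net|) u x tau], the exterior terms having cancelled. *)
Lemma record_patch (net : seq 'rV[R]_N) (C1 : R) : 0 < T -> 0 <= C1 ->
  (forall (zc : 'rV[R]_N -> 'rV[R]_N) x t, 0 <= t < T ->
    (forall c, c \in net -> bdry Om (zc c) /\ enorm (zc c - c) < d / 8) -> K x ->
    out t x <= C1 * \sum_(c <- net) out t (zc c)) ->
  exists k M0, [/\ 0 < k, 0 <= M0 & forall x tau, record_point x tau -> M0 < u x tau ->
    exists2 c, c \in net & forall z, bdry Om z -> enorm (z - c) < d / 8 ->
      k * u x tau <= u z tau].
Proof.
move=> T0 C10 ctl; pose n : R := (size net)%:R.
have n0 : 0 <= n by [].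
have Cn0 : 0 <= C1 * n by rewrite mulr_ge0.
pose C' := 1 + C1 * n; have C'0 : 0 < C' by rewrite ltr_pwDl.
(* Starting this close to [T] limits the total growth at rate [C' M] to [M / 8]; [T / 2] keeps the
   start positive. *)
pose t0 := Num.max (T / 2) (T - (8 * C')^-1).
have t00 : 0 < t0 by rewrite lt_max divr_gt0.
have C'i : 0 < (8 * C')^-1 by rewrite invr_gt0 mulr_gt0.
have t0T : t0 < T by rewrite gt_max ltr_pdivrMr// ltr_pMr// ltr1n/= ltrBlDr ltrDl.
have t0C : (T - t0) * C' <= 1 / 8.
  have : T - t0 <= (8 * C')^-1 by rewrite lerBlDr -lerBlDl le_max lexx orbT.
  move=> /(ler_wpM2r (ltW C'0)); rewrite invfM -mulrA mulVf ?gt_eqF// mulr1; lra.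
have [M0 M00 uM0] := sol_bounded_itv t0T.
(* This [k] makes the subtracted sum at [tau] at most [M / 2], and the value at [t0] is below
   [M / 4]; the increment would then exceed [M / 4], against [M / 8]. *)
exists (2 * C')^-1, (4 * M0); split; rewrite ?invr_gt0 ?mulr_gt0 ?mulr_ge0//.
move=> x tau [Kx tauT rec] big.
set M := u x tau in rec big *.
have Mp : 0 < M by apply: le_lt_trans big; rewrite mulr_ge0.
apply: contrapT => none.
(* One bad point per patch, chosen at time [tau] and then followed on all of [[t0, tau]]. *)
have /choice[zc zcP] c : exists z, c \in net ->
    [/\ bdry Om z, enorm (z - c) < d / 8 & u z tau < (2 * C')^-1 * M].
  have [cn|cn] := boolP (c \in net); last by exists 0.
  apply: contrapT => nz; apply: none; exists c => // z bz zc.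
  by rewrite leNgt; apply/negP => uz; apply: nz; exists z.
have t0tau : t0 < tau.
  rewrite ltNge; apply/negP => tt; have := uM0 x tau Kx.
  by case/andP: tauT => -> _ /=; rewrite tt => /(_ isT); rewrite -/M; lra.
have [tau0 tauT'] := andP tauT.
have Kzc c : c \in net -> K (zc c) by move=> /zcP[/bdry_dom_closure].
pose Psi (s : R) := \sum_(c <- net) u (zc c) s.
pose psi (s : R) := u x s + - (C1 * Psi s).
pose dpsi (s : R) := rhs x s + - (C1 * \sum_(c <- net) rhs (zc c) s).
have psid s : 0 < s < T -> is_derive s 1 psi (dpsi s).
  move=> sT; have S : is_derive s 1 Psi (\sum_(c <- net) rhs (zc c) s).
    by apply: is_derive_sum_seq => c cn; exact: sol_is_derive (Kzc _ cn) sT.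
  exact: is_deriveD (sol_is_derive Kx sT) (is_deriveN (is_deriveZ C1 S)).
have inT s : t0 <= s <= tau -> 0 < s < T.
  by move=> /andP[a b]; rewrite (lt_le_trans t00 a) (le_lt_trans b).
have inTo s : t0 < s < tau -> 0 < s < T.
  by move=> /andP[a b]; apply: inT; rewrite !ltW.
have cpsi : {within `[t0, tau], continuous psi}.
  apply: derivable_within_continuous => s; rewrite in_itv/= => /inT /psid.
  by case.
have incr := @derive_le_increment R psi dpsi t0 tau (C' * M) (ltW t0tau) (fun s h => psid s (inTo s h)) cpsi.
have size_sum (a : R) : \sum_(c <- net) a = n * a.
  by rewrite big_const_seq count_predT iter_addr_0 mulr_natl.
have bound s : t0 < s < tau -> dpsi s <= C' * M.
  move=> sI; have sT := inTo _ sI; have sT' : 0 <= s < T by case/andP: sT => /ltW -> ->.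
  have uM y : K y -> u y s <= M.
    by move=> Ky; apply: rec => //; case/andP: sT' => -> _; case/andP: sI => _ /ltW ->.
  have zcP' c : c \in net -> bdry Om (zc c) /\ enorm (zc c - c) < d / 8 by move=> /zcP[].
  have c1 := ctl zc x s sT' zcP' Kx.
  have c2 := rhs_le Kx sT uM.
  have c3 : \sum_(c <- net) (- M + out s (zc c)) <= \sum_(c <- net) rhs (zc c) s.
    rewrite big_seq [leRHS]big_seq; apply: ler_sum => c cn.
    apply: le_trans (rhs_ge (Kzc _ cn) sT).
    by rewrite lerD2r lerN2 uM//; exact: Kzc.
  rewrite big_split/= size_sum in c3.
  have := ler_wpM2l C10 c3; rewrite mulrDr /dpsi /C' => c4; lra.
have {}incr := incr bound.
have C1n : C1 * n * (2 * C')^-1 <= 1 / 2.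
  rewrite invfM mulrCA ler_pdivrMl// ?mulr_gt0//.
  rewrite -[C1 * n / C']mulrC; have : C'^-1 * (C1 * n) <= 1.
    by rewrite ler_pdivrMl// mulr1 /C' lerDr.
  lra.
have Psi_tau : C1 * Psi tau <= M / 2.
  have : Psi tau <= \sum_(c <- net) ((2 * C')^-1 * M).
    rewrite /Psi big_seq [leRHS]big_seq; apply: ler_sum => c cn.
    by have [_ _ /ltW] := zcP _ cn.
  rewrite size_sum => /(ler_wpM2l C10) H; apply: le_trans H _.
  by have := ler_wpM2r (ltW Mp) C1n; lra.
have Psi_t0 : 0 <= C1 * Psi t0.
  rewrite mulr_ge0// /Psi big_seq; apply: sumr_ge0 => c cn.
  by apply: sol_ge0; [exact: Kzc|rewrite ltW].
have ut0 : u x t0 <= M0 by apply: uM0 => //; rewrite (ltW t00)/=.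
have tC : C' * M * (tau - t0) <= M / 8.
  have : (tau - t0) * C' <= (T - t0) * C' by rewrite ler_wpM2r ?(ltW C'0)// lerD2r ltW.
  by move=> /le_trans /(_ t0C) /(ler_wpM2r (ltW Mp)); lra.
move: incr; rewrite /psi -/M => incr; lra.
Qed.

Lemma record_growth : 0 < T -> exists k M0, [/\ 0 < k, 0 <= M0 &
  forall x tau, record_point x tau -> M0 < u x tau -> forall s, tau <= s < T ->
    exists2 y, K y & k * (s - tau) * u x tau `^ p <= u y s].
Proof.
move=> T0; have [net [C1 [netb netP C10 ctl]]] := outer_control.
have [k [M0 [k0 M00 patch]]] := record_patch T0 C10 ctl.
have r0 : 0 <= 3 / 4 * d by rewrite mulr_ge0// ltW.
have Jr y : enorm y <= 3 / 4 * d -> 0 < J y.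
  by move=> yd; apply: Jpos; apply: le_lt_trans yd _; have : 0 < d := d0; lra.
have [j0 j00 Jj0] := kernel_lower cJ r0 Jr.
(* The constant is found for each centre, uniformly in the record; finiteness of the net then gives
   a common one. *)
pose P c k2 := forall x tau, record_point x tau -> M0 < u x tau ->
  (forall z, bdry Om z -> enorm (z - c) < d / 8 -> k * u x tau <= u z tau) ->
  forall s, tau <= s < T -> k2 * (s - tau) * u x tau `^ p <= u c s.
have [c cn|c k2 k2' k2'0 kk H x tau rec big pat s sI|k2 k20 H] := @seq_common_pos R _ net P.
- have [a [h [h0 cubeP]]] := bdry_exterior_cube (netb _ cn).
  have Kc := bdry_dom_closure (netb _ cn).
  (* Bounds the damping from below over every time interval inside [[0, T)]. *)
  pose e := expR (- T); have e0 : 0 < e by exact: expR_gt0.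
  have ek0 : 0 < e * k by rewrite mulr_gt0.
  (* Kernel bound, values persisting on the patch to the power [p], volume of the exterior cube, and
     the damping at [c] itself. *)
  exists (e * (j0 * (e * k) `^ p * h ^+ N)).
    by rewrite !mulr_gt0 ?powR_gt0 ?exprn_gt0.
  move=> x tau [Kx tauT rec] big pat s /andP[taus sT].
  set M := u x tau in rec big pat *.
  have Mp : 0 <= M by apply: ltW; exact: le_lt_trans big.
  have [tau0 _] := andP tauT.
  have e_le r : tau <= r -> r < T -> e <= expR (- (r - tau)).
    by move=> tr rT; rewrite ler_expR lerN2; lra.
  (* On the patch [u] decays no faster than exponentially, since [rhs >= - u]. *)
  have persist z r : bdry Om z -> enorm (z - c) < d / 8 -> tau <= r -> r < T -> e * k * M <= u z r.
    move=> bz zc tr rT; have Kz := bdry_dom_closure bz.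
    have sub q : tau < q < r -> 0 < q < T.
      by move=> /andP[q1 q2]; rewrite (le_lt_trans tau0 q1) (lt_trans q2).
    have := @damped_growth R (u z) (fun q => rhs z q) tau r 0 tr (lexx _)
      (fun q h => sol_is_derive Kz (sub q h)) (sol_continuous_itv Kz tau0 rT).
    have drift q : tau < q < r -> - u z q + 0 <= rhs z q.
      move=> /sub qT; apply: le_trans (rhs_ge Kz qT).
      by rewrite lerD2l; exact: outer_ge0.
    move=> /(_ drift); rewrite mulr0 addr0; apply: le_trans.
    rewrite -mulrA; apply: ler_pM; rewrite ?(ltW e0) ?mulr_ge0 ?(ltW k0)//; first exact: e_le.
    exact: pat.
  pose B := j0 * ((e * k) `^ p * M `^ p) * h ^+ N.
  have B0 : 0 <= B by rewrite !mulr_ge0 ?powR_ge0 ?exprn_ge0// ltW.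
  have sub q : tau < q < s -> 0 < q < T.
    by move=> /andP[q1 q2]; rewrite (le_lt_trans tau0 q1) (lt_trans q2).
  have outB q : tau < q < s -> B <= out q c.
    move=> qI; have qT := sub _ qI; have qT' : 0 <= q < T by case/andP: qT => /ltW -> ->.
    have cu := joint_continuous_space sol_joint_continuous qT'.
    have uge z : K z -> 0 <= u z q by move=> Kz; exact: sol_ge0.
    have [A [C [A0 bb]]] := outer_density_bounded Om_bounded Om0 rhoOm coords cJ J0 d0 ds0 p1 Jd cu uge Kc.
    pose w := j0 * ((e * k) `^ p * M `^ p).
    have w0 : 0 <= w by rewrite !mulr_ge0 ?powR_ge0// ltW.
    have := @iint_step R N unit [:: tt] (fun _ => w) (fun _ => a) h (ltW h0) (fun _ => w0).
    rewrite big_seq1 /B -/w => <-; apply: (iint_le A0 bb) => y.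
    rewrite /step big_seq1; case: (boolP (cube a h y)) => [ya|_]; last first.
      by rewrite mulr0; exact: outer_density_ge0.
    have [z [r [ny zc yc]]] := cubeP _ ya.
    rewrite mulr1 (outer_density_normal_coord coords _ _ _ _ _ ny).
    have bz : bdry Om z by case: ny.
    rewrite /w -powRM ?(ltW ek0)//; apply: ler_pM; rewrite ?powR_ge0 ?(ltW j00)//.
      by apply: Jj0; rewrite enormC.
    apply: ge0_ler_powR; rewrite ?nnegrE ?mulr_ge0 ?(ltW e0) ?(ltW k0)//.
    - by apply: ltW; exact: lt_trans p1.
    - by apply: uge; exact: bdry_dom_closure bz.
    - by apply: persist => //; case/andP: qI => [/ltW//]; case/andP: qT.
  have := @damped_growth R (u c) (fun q => rhs c q) tau s B taus B0
      (fun q h => sol_is_derive Kc (sub q h)) (sol_continuous_itv Kc tau0 sT).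
  have drift q : tau < q < s -> - u c q + B <= rhs c q.
    by move=> qI; apply: le_trans (rhs_ge Kc (sub _ qI)); rewrite lerD2l outB.
  move=> /(_ drift); apply: le_trans.
  have st : 0 <= s - tau by rewrite subr_ge0.
  have -> : e * (j0 * (e * k) `^ p * h ^+ N) * (s - tau) * M `^ p = e * ((s - tau) * B).
    by rewrite /B; ring.
  have sB0 : 0 <= (s - tau) * B by exact: mulr_ge0.
  apply: le_trans (ler_wpM2r sB0 (e_le s taus sT)) _.
  by rewrite ler_wpM2l ?expR_ge0// lerDr; exact: sol_ge0.
- apply: le_trans (H x tau rec big pat s sI).
  by rewrite ler_wpM2r ?powR_ge0// ler_wpM2r// subr_ge0; case/andP: sI.
- exists k2, M0; split => // x tau rec big s sI.
  have [c cn pat] := patch _ _ rec big.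
  exists c; first exact: bdry_dom_closure (netb _ cn).
  exact: H rec big pat s sI.
Qed.

(* Comparison with [w t = (q - b (t - t1)) `^ (- (p - 1)^-1)], a strict supersolution of
   [w' = w `^ p] as soon as [b > p - 1]. *)
Lemma sol_lt_barrier (q b t1 t2 : R) : 0 <= t1 -> t1 <= t2 -> t2 < T -> p - 1 < b ->
  b * (T - t1) < q -> (forall x, K x -> u x t1 < q `^ (- (p - 1)^-1)) ->
  forall x, K x -> u x t2 < (q - b * (T - t1)) `^ (- (p - 1)^-1).
Proof.
move=> t10 t12 t2T pb bq ut1 x Kx.
have pp : 0 < p - 1 by rewrite subr_gt0.
have b0 : 0 < b := lt_trans pp pb.
have pi : 0 < (p - 1)^-1 by rewrite invr_gt0.
pose e := (p - 1)^-1; pose w (t : R) := (q - b * (t - t1)) `^ (- e).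
have basep t : t <= t2 -> q - b * (T - t1) <= q - b * (t - t1).
  by move=> tt2; rewrite lerD2l lerN2 ler_pM2l// lerD2r; apply: le_trans tt2 (ltW t2T).
have base0 t : t <= t2 -> 0 < q - b * (t - t1).
  by move=> /basep; apply: lt_le_trans; rewrite subr_gt0.
have wd t : t <= t2 -> is_derive t 1 w (b * e * w t `^ p).
  move=> tt2; have B0 := base0 t tt2.
  have ad : is_derive t 1 (fun s : R => q - b * (s - t1)) (- b).
    have sd : is_derive t 1 (fun s : R => s - t1) 1.
      by have := is_deriveB (is_derive_id t (1 : R)) (is_derive_cst t1 t (1 : R)); rewrite subr0.
    have bd : is_derive t 1 (fun s : R => b * (s - t1)) (b * 1).
      exact: (is_deriveZ b sd).
    by have := is_deriveB (is_derive_cst q t (1 : R)) bd; rewrite sub0r mulr1.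
  have -> : b * e * w t `^ p = - e * (q - b * (t - t1)) `^ (- e - 1) * - b.
    rewrite /w -powRrM (_ : - e * p = - e - 1); first ring.
    by rewrite /e; field; rewrite gt_eqF.
  exact: (@is_derive1_comp R (fun y : R => y `^ (- e)) (fun s : R => q - b * (s - t1)) t _ _
     (is_derive_powR (- e) B0) ad).
have wI t : t <= t2 -> w t <= (q - b * (T - t1)) `^ (- (p - 1)^-1).
  by move=> tt2; apply: powRN_le; [rewrite subr_gt0|exact: basep|exact: ltW].
rewrite ltNge; apply/negP => ux.
pose g (y : 'rV[R]_N) (s : R) := u y s + - w s.
have cg : joint_continuous K `[t1, t2] g.
  apply: joint_continuousD; first exact: sol_joint_continuous_itv.
  apply: derivable_within_continuous => s; rewrite in_itv/= => /andP[_ st2].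
  by apply: derivableN; case: (wd s st2).
have [||y [s [Ky /andP[t1s st2] gys before now]]] := first_touch cK clK cg.
- by move=> y Ky; rewrite /g /w subrr mulr0 subr0 subr_lt0; exact: ut1.
- exists x, t2; split => //; first by rewrite t12 lexx.
  by rewrite /g subr_ge0; apply: le_trans ux; exact: wI.
have sT : 0 < s < T by rewrite (le_lt_trans t10 t1s) (le_lt_trans st2).
have uw : u y s = w s by apply/eqP; rewrite -subr_eq0; apply/eqP; exact: gys.
have D0 : 0 <= rhs y s + - (b * e * w s `^ p).
  have gd : is_derive s 1 (g y) (rhs y s + - (b * e * w s `^ p)).
    exact: is_deriveD (sol_is_derive Ky sT) (is_deriveN (wd s st2)).
  apply: (is_derive_ge0_left gd t1s) => r rs.
  by rewrite gys; apply: ltW; exact: before.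
have : rhs y s <= u y s `^ p.
  by apply: rhs_le_powR => // z Kz; rewrite uw; have := now _ Kz; rewrite /g subr_le0.
rewrite uw; have w0 : 0 < w s `^ p by rewrite !powR_gt0// base0.
have be : 1 < b * e by rewrite /e -/(b / (p - 1)) ltr_pdivlMr// mul1r.
have := ltr_pM2r w0 1 (b * e); rewrite be mul1r; lra.
Qed.

(** * Lower and upper blow-up rates *)

(** A strict violation leaves room for a barrier above [u] at [t1] whose base is still positive at
    [T]. The norm then stays bounded up to [T], against blow-up. *)
Lemma lower_rate t1 : 0 <= t1 < T -> (Linf Om u t @[t --> at_left T] --> +oo) ->
  (p - 1) `^ (- (p - 1)^-1) * (T - t1) `^ (- (p - 1)^-1) <= Linf Om u t1.
Proof.
move=> tT blow; have [t10 t1T] := andP tT.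
have pp : 0 < p - 1 by rewrite subr_gt0.
have Tt : 0 < T - t1 by rewrite subr_gt0.
rewrite -powRM ?(ltW pp) ?(ltW Tt)//.
set Q := (p - 1) * (T - t1); set e := (p - 1)^-1.
have Q0 : 0 < Q by rewrite mulr_gt0.
rewrite leNgt; apply/negP => small.
have gap : 0 < Q `^ (- e) - Linf Om u t1 by rewrite subr_gt0.
have QD : derivable (fun b : R => b `^ (- e)) Q 1 by case: (is_derive_powR (- e) Q0).
have /derivable1_diffP/differentiable_continuous/cvgrPdist_lt/(_ _ gap) := QD.
move=> /nbhs_normP[r /= r0 rP].
have r2 : 0 < r / 2 by rewrite divr_gt0.
have r4 : 0 < r / 4 by rewrite divr_gt0.
have qr : `|Q - (Q + r / 2)| < r by rewrite opprD addNKr normrN gtr0_norm//; lra.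
have := rP (Q + r / 2) qr; rewrite ltr_norml => /andP[_ H].
have Lq : Linf Om u t1 < (Q + r / 2) `^ (- e) by lra.
(* Steeper than [p - 1], yet the base, starting at [Q + r / 2], still equals [r / 4] at time [T]. *)
pose b := p - 1 + r / 4 / (T - t1).
have bT : b * (T - t1) = Q + r / 4 by rewrite /b mulrDl divfK// gt_eqF.
have pb : p - 1 < b by rewrite ltrDl divr_gt0.
have bq : b * (T - t1) < Q + r / 2 by rewrite bT; lra.
have ut1 x : K x -> u x t1 < (Q + r / 2) `^ (- e).
  by move=> Kx; apply: le_lt_trans Lq; exact: Linf_ge.
have /cvgryPgt/(_ ((Q + r / 2 - b * (T - t1)) `^ (- e))) := blow.
move=> near_big.
have [t [big t1t tltT]] : exists t, [/\ (Q + r / 2 - b * (T - t1)) `^ (- e) < Linf Om u t, t1 < t & t < T].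
  apply: (@filter_ex _ (at_left T)); near=> t; split.
  - by near: t; exact: near_big.
  - by near: t; exact: nbhs_left_gt.
  - by near: t; exact: nbhs_left_lt.
move: big; rewrite /= ltNge => /negP; apply.
apply: Linf_le => [|x Kx]; first by rewrite tltT (ltW (le_lt_trans t10 t1t)).
by apply: ltW; apply: sol_lt_barrier => //; exact: ltW.
Unshelve. all: by end_near. Qed.

Lemma record_time_bound : 0 < T -> exists C M0, [/\ 0 < C, 0 < M0 &
  forall x tau, record_point x tau -> M0 < u x tau -> T - tau <= C * u x tau `^ (1 - p)].
Proof.
move=> T0; have [k [M1 [k0 M10 growth]]] := record_growth T0.
pose th : R := 2 `^ (1 - p).
have pp : 0 < p - 1 by rewrite subr_gt0.
have th0 : 0 < th by rewrite powR_gt0.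
have th1 : th < 1.
  rewrite /th (_ : 1 - p = - (p - 1)); last by rewrite opprB.
  rewrite powRN invf_lt1 ?powR_gt0//.
  by have := @gt0_ltr_powR R _ pp 1 2; rewrite powR1 !nnegrE; apply; rewrite ?ltr1n.
(* The sum of the geometric series, characterised by [C = 2 / k + C th]: the cost of one doubling
   plus the remaining cost from [2 M]. *)
pose C := 2 / k / (1 - th).
have th1' : 0 < 1 - th by rewrite subr_gt0.
have C0 : 0 < C by rewrite !divr_gt0.
have Cth : 2 / k + C * th = C by rewrite /C; field; rewrite !gt_eqF.
exists C, (M1 + 1); split => //; first by rewrite ltr_wpDl.
(* While values stay below [2 M], the linear growth [k (s - tau) M ^ p <= 2 M] limits the elapsed
   time. *)
have step x tau s y : 0 < u x tau -> k * (s - tau) * u x tau `^ p <= u y s ->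
    u y s <= 2 * u x tau -> s - tau <= 2 / k * u x tau `^ (1 - p).
  set M := u x tau => Mp a b.
  have Mpp : 0 < M `^ p by rewrite powR_gt0.
  have -> : M `^ (1 - p) = M / M `^ p.
    rewrite powRB ?powRr1 ?(ltW Mp)//.
    by rewrite (gt_eqF Mp) implybT.
  have E : 2 / k * (M / M `^ p) = (2 * M) / (k * M `^ p).
    by field; rewrite !gt_eqF.
  by rewrite E ler_pdivlMr ?mulr_gt0//; apply: le_trans b; lra.
(* Induction on the number of doublings available before [s], with a constant independent of [n]. *)
have main n : forall x tau s, record_point x tau -> M1 + 1 < u x tau -> tau <= s < T ->
    (forall y r, K y -> 0 <= r <= s -> u y r <= 2 ^+ n * u x tau) ->
    s - tau <= C * u x tau `^ (1 - p).
  have basics x tau : M1 + 1 < u x tau -> [/\ 0 < u x tau, M1 < u x tau &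
      2 / k * u x tau `^ (1 - p) <= C * u x tau `^ (1 - p)].
    move=> big; split; first by apply: lt_trans big; rewrite ltr_wpDl.
      by apply: lt_trans big; rewrite ltrDl.
    by rewrite ler_wpM2r ?powR_ge0// -Cth lerDl mulr_ge0// ltW.
  elim: n => [|n IH] x tau s rec big sI ub.
    have [taus sT] := andP sI; have [Mp big1 C2] := basics x tau big.
    have [Kx /andP[tau0 tauT] recP] := rec.
    have [y Ky gy] := growth x tau rec big1 s sI.
    apply: le_trans C2; apply: (step _ _ _ y) => //.
    have := ub y s Ky; rewrite expr0 mul1r lexx (le_trans tau0 taus) => /(_ isT).
    by move=> /le_trans; apply; rewrite ler_peMl ?(ltW Mp)// ler1n.
  have [taus sT] := andP sI; have [Mp big1 C2] := basics x tau big.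
  have [Kx /andP[tau0 tauT] recP] := rec.
  have [[y [r [Ky rI yr]]]|none] :=
      pselect (exists y r, [/\ K y, tau <= r <= s & 0 <= u y r + - (2 * u x tau)]); last first.
    have [y Ky gy] := growth x tau rec big1 s sI.
    apply: le_trans C2; apply: (step _ _ _ y) => //.
    rewrite leNgt; apply/negP => yb; apply: none; exists y, s; split => //.
      by rewrite taus lexx.
    by rewrite subr_ge0 ltW.
  (* The first contact with [2 M] is itself a record, from which the induction continues. *)
  pose g (y : 'rV[R]_N) (s : R) := u y s + - (2 * u x tau).
  have cg : joint_continuous K `[tau, s] g.
    apply: joint_continuousD; first exact: sol_joint_continuous_itv.
    by apply: continuous_subspaceT => ?; exact: cvg_cst.
  have [||z [q [Kz /andP[tauq qs] gzq before now]]] := first_touch cK clK cg.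
  - move=> z Kz; rewrite /g subr_lt0.
    have := recP z tau Kz; rewrite tau0 lexx => /(_ isT) /le_lt_trans; apply.
    by rewrite ltr_pMl// ltr1n.
  - by exists y, r.
  have uz : u z q = 2 * u x tau by apply/eqP; rewrite -subr_eq0; apply/eqP; exact: gzq.
  have qT : q < T := le_lt_trans qs sT.
  have recq : record_point z q.
    split => //; first by rewrite (le_trans tau0 (ltW tauq)).
    move=> w r' Kw /andP[r0 rq]; rewrite uz.
    have [rt|rt] := leP r' tau.
      have := recP w r' Kw; rewrite r0 rt => /(_ isT) /le_trans; apply.
      by rewrite ler_peMl ?(ltW Mp)// ler1n.
    move: rq; rewrite le_eqVlt => /predU1P[->|rq]; first by have := now w Kw; rewrite /g subr_le0.
    by have := before w r' Kw; rewrite (ltW rt) rq => /(_ isT) /ltW; rewrite /g subr_le0.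
  have qI : tau <= q < T by rewrite (ltW tauq).
  have [y' Ky' gy'] := growth x tau rec big1 q qI.
  have d1 : q - tau <= 2 / k * u x tau `^ (1 - p).
    apply: (step _ _ _ y') => //.
    by have := now y' Ky'; rewrite /g subr_le0.
  have bigq : M1 + 1 < u z q.
    by apply: lt_trans big _; rewrite uz ltr_pMl// ltr1n.
  have qsT : q <= s < T by rewrite qs.
  have := IH z q s recq bigq qsT.
  rewrite uz => /(_ _) H.
  have d2 : s - q <= C * (2 * u x tau) `^ (1 - p).
    apply: H => w r' Kw rI'; rewrite mulrA -exprSr; exact: ub.
  rewrite powRM ?(ltW Mp)// -/th in d2.
  rewrite -[C in leRHS]Cth mulrDl -mulrA; lra.
move=> x tau rec big; have [Kx /andP[tau0 tauT] recP] := rec.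
have Mp : 0 < u x tau by apply: lt_trans big; rewrite ltr_wpDl.
rewrite leNgt; apply/negP => far.
pose s := tau + C * u x tau `^ (1 - p).
have Cs : 0 < C * u x tau `^ (1 - p) by rewrite mulr_gt0// powR_gt0.
(* A time past the claimed bound but before [T]: there [u] is bounded, so finitely many doublings
   suffice. *)
pose s' := (s + T) / 2.
have sT : s < T by rewrite /s; lra.
have s'T : s' < T by rewrite /s'; lra.
have ss' : s < s' by rewrite /s'; lra.
have tau_s' : tau <= s' by rewrite /s in ss'; lra.
have [B B0 uB] := sol_bounded_itv s'T.
pose n := (Num.truncn (B / u x tau)).+1.
have nB : B <= 2 ^+ n * u x tau.
  rewrite -ler_pdivrMr//; apply: le_trans (ltW (truncnS_gt _)) _.
  by rewrite -natrX ler_nat ltnW// ltn_expl.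
have := main n x tau s' rec big.
rewrite tau_s' s'T => /(_ isT) H.
have : s' - tau <= C * u x tau `^ (1 - p).
  by apply: H => y r Ky rI; apply: le_trans nB; exact: uB.
by rewrite /s in ss'; lra.
Qed.

Lemma upper_rate : 0 < T -> exists C : R, forall t, 0 <= t < T ->
  Linf Om u t <= C * (T - t) `^ (- (p - 1)^-1).
Proof.
move=> T0; have [C [M0 [C0 M00 bound]]] := record_time_bound T0.
have pp : 0 < p - 1 by rewrite subr_gt0.
set e := (p - 1)^-1; have e0 : 0 < e by rewrite invr_gt0.
(* The first summand covers times when the record is still at most [M0], the second all others. *)
exists (M0 * T `^ e + C `^ e) => t tT; have [t0 tltT] := andP tT.
have Tt : 0 < T - t by rewrite subr_gt0.
have Te0 : 0 < (T - t) `^ (- e) by rewrite powR_gt0.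
have [x [tau [Kx /andP[tau0 taut] rec]]] := exists_record tT.
have LM : Linf Om u t <= u x tau by apply: Linf_le => // y Ky; apply: rec => //; rewrite t0 lexx.
have Ce := powR_ge0 C e.
have MT : M0 <= M0 * T `^ e * (T - t) `^ (- e).
  rewrite -mulrA ler_peMr ?(ltW M00)//.
  have : T `^ (- e) <= (T - t) `^ (- e) by apply: powRN_le => //; [rewrite gerBl|exact: ltW].
  have Te : 0 < T `^ e by rewrite powR_gt0.
  by move=> /(ler_wpM2l (ltW Te)); rewrite {1}powRN divff// gt_eqF.
rewrite mulrDl; have [small|big] := leP (u x tau) M0.
  apply: (le_trans LM); apply: (le_trans small); apply: (le_trans MT).
  by rewrite lerDl mulr_ge0// ltW.
have Mp : 0 < u x tau := lt_trans M00 big.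
have recx : record_point x tau.
  split => //; first by rewrite tau0 (le_lt_trans taut).
  by move=> y s Ky /andP[s00 st]; apply: rec => //; rewrite s00 (le_trans st).
have TM : T - t <= C * u x tau `^ (1 - p).
  by apply: le_trans (bound x tau recx big); rewrite lerD2l lerN2.
have key : u x tau <= C `^ e * (T - t) `^ (- e).
  have Mpp : 0 < u x tau `^ (p - 1) by rewrite powR_gt0.
  have H : u x tau `^ (p - 1) <= C / (T - t).
    rewrite ler_pdivlMr// mulrC -ler_pdivlMr//.
    by move: TM; rewrite -(opprB p 1) powRN.
  have -> : u x tau = (u x tau `^ (p - 1)) `^ e.
    by rewrite -powRrM divff ?gt_eqF// powRr1// ltW.
  apply: le_trans (_ : (C / (T - t)) `^ e <= _).
    apply: ge0_ler_powR H; rewrite ?nnegrE ?(ltW e0) ?(ltW Mpp)//.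
    by rewrite divr_ge0// ltW.
  rewrite powRM ?(ltW C0) ?invr_ge0 ?(ltW Tt)//.
  by rewrite -[(T - t)^-1]powR_inv1 ?(ltW Tt)// -powRrM mulN1r.
apply: (le_trans LM); apply: (le_trans key).
by rewrite lerDr; apply: le_trans MT; exact: ltW.
Qed.

End Solution.


Theorem theorem5p5 (R : realType) (N : nat) (Om : set 'rV[R]_N)
  (rho : 'rV[R]_N -> R) (J : 'rV[R]_N -> R) (d s0 p T : R)
  (u0 : 'rV[R]_N -> R) (u : 'rV[R]_N -> R -> R) :
  (* standing assumptions on Omega *)
  bounded_smooth_domain Om -> defining_function Om rho ->
  (* standing assumptions on J *)
  continuous J -> (forall x, 0 <= J x) -> (forall x, J (- x) = J x) ->
  iint J = 1 -> 0 < d ->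
  (forall x, enorm x < d -> 0 < J x) -> (forall x, d <= enorm x -> J x = 0) ->
  (* normal coordinates near the boundary, with s0 > d *)
  d < s0 -> normal_coordinates Om (ext_normal rho) s0 ->
  (* data and blow-up *)
  1 < p ->
  {within closure Om, continuous u0} -> (forall x, closure Om x -> 0 <= u0 x) ->
  blows_up Om J (ext_normal rho) s0 p u0 T u ->
  exists C : R, forall t, 0 <= t < T ->
    (p - 1) `^ (- (p - 1)^-1) * (T - t) `^ (- (p - 1)^-1) <= Linf Om u t /\
    Linf Om u t <= C * (T - t) `^ (- (p - 1)^-1).
Proof.
move=> [Om_bounded [Om0 _]] rhoOm cJ J0 Jsym J1 d0 Jpos Jd ds0 coords p1 _ u0_ge0 [sol blow].
have [T0|T0] := ltP 0 T; last first.
  by exists 0 => t /andP[t0 tT]; have := le_lt_trans t0 (lt_le_trans tT T0); rewrite ltxx.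
have [C upper] := upper_rate Om_bounded Om0 rhoOm cJ J0 Jsym J1 d0 Jpos Jd ds0 coords p1 u0_ge0 sol T0.
exists C => t tT; split; last exact: upper.
exact: (lower_rate Om_bounded Om0 rhoOm cJ J0 Jsym J1 d0 Jd ds0 coords p1 u0_ge0 sol tT blow).
Qed.
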